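(* Let $H$ be a many-body Hamiltonian on $\mathbb R^n$ such that $\Lambda_1$ is discrete. Then $H$ has a globally broken bicharacteristic relation, and there is a constant $M$ such that every generalized broken bicharacteristic of $H$ (of any energy $\lambda\in\mathbb R$) has at most $M$ breaks.
   Context: Many-body Hamiltonian. $\{X_a\}_{a\in I}$ is a finite family of linear subspaces of Euclidean $\mathbb R^n$, closed under intersections, containing $X_0=\mathbb R^n$ and $X_1=\{0\}$. $X^a=X_a^\perp$, $\pi^a$ is the orthogonal projection to $X^a$; $\xi=(\xi_a,\xi^a)$ is the splitting along $X_a\oplus X^a$ (dual spaces identified via the metric). $a\le b$ means $X^a\subset X^b$. $H=\Delta+\sum_a(\pi^a)^*V_a$ with $\Delta\ge0$ the positive Laplacian, $V_0=0$, $V_a$ real-valued and $V_a\in S^{-1}_{\rm phg}(X^a)$ (classical one-step polyhomogeneous symbols of order $-1$). $H^a=\Delta_{X^a}+\sum_{b\le a}V_b$ on $L^2(X^a)$ ($H^0=0$ on $L^2(\{0\})=\mathbb C$). $\mathrm{spec}_{pp}$ denotes the set of $L^2$-eigenvalues. $\Lambda_1=\bigcup_{b<1}\mathrm{spec}_{pp}(H^b)$ is the set of thresholds (closed and bounded, so discrete means finite). Phase space. $C_a=X_a\cap\mathbb S^{n-1}$, $C_a'=C_a\setminus\bigcup_{b\not\le a}C_b$; the $C'_a$ partition $\mathbb S^{n-1}$. $\dot T=\bigsqcup_a C_a'\times X_a$, $\pi:\mathbb S^{n-1}\times\mathbb R^n\to\dot T$, $\pi(\omega,\xi)=(\omega,\xi_a)$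 for $\omega\in C_a'$; $\dot T$ has the quotient topology. $\pi_b:C_b\times X_b\to\dot T$ is the restriction of $\pi$ to $C_b\times X_b\subset\mathbb S^{n-1}\times\mathbb R^n$. $\Sigma_b(\lambda)=\{(\omega,\xi_b)\in C_b\times X_b:\lambda-|\xi_b|^2\in\mathrm{spec}_{pp}(H^b)\}$, $\hat\pi_b=\pi_b|_{\Sigma_b(\lambda)}$, $\dot\Sigma(\lambda)=\bigcup_b\pi_b(\Sigma_b(\lambda))$. Generalized broken bicharacteristics. The rescaled Hamilton vector field ${}^{sc}H_g^b$ on $C_b\times X_b$ is $\dot\omega=2(\xi_b-(\omega\cdot\xi_b)\omega)$, $\dot\xi_b=0$; ${}^{sc}H_g={}^{sc}H_g^0$. $f\in C^\infty(\mathbb S^{n-1}\times\mathbb R^n)$ is $\pi$-invariant if $f=f_\pi\circ\pi$ for some $f_\pi$ on $\dot T$. A generalized broken bicharacteristic of $H-\lambda$ is a continuous $\gamma:J\to\dot\Sigma(\lambda)$, $J\subset\mathbb R$ an interval, such that for all $t_0\in J$, both signs, and all $\pi$-invariant $f$: if $\gamma(t_0)=\xi_0\in C_a'\times X_a$, then $D_\pm(f_\pi\circ\gamma)(t_0)\ge\inf\{{}^{sc}H_g^bf(\tilde\xi_0):\tilde\xi_0\in\hat\pi_b^{-1}(\xi_0),\ C_a\subset C_b\}$, where $D_\pm h(t_0)=\liminf_{t\to t_0\pm}(h(t)-h(t_0))/(t-t_0)$. Breaks. $H$ has a globally broken bicharacteristic relation if for all generalized broken bicharacteristics $\gamma:\mathbb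 R\to\dot\Sigma(\lambda)$ there exist $t_0<\ldots<t_k$ such that $\gamma|_{(-\infty,t_0]}$, $\gamma|_{[t_k,+\infty)}$ and each $\gamma|_{[t_j,t_{j+1}]}$ are projections (under $\pi$) to $\dot\Sigma(\lambda)$ of integral curves of ${}^{sc}H_g$. A generalized broken bicharacteristic on an interval $J$ has at most $M$ breaks if $J$ can be divided by at most $M$ points into closed (in $J$) subintervals on each of which $\gamma$ is such a projection. *)

(* Defs.v *)
From HB Require Import structures.
From mathcomp Require Import all_boot all_order all_algebra.
From mathcomp Require Import all_classical all_reals all_analysis.
From mathcomp Require sesquilinear.
From mathcomp.real_closed Require Import complex.

Set Implicit Arguments.
Unset Strict Implicit.
Unset Printing Implicit Defensive.

Import Order.TTheory GRing.Theory Num.Theory.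
Import numFieldNormedType.Exports.

Local Open Scope classical_set_scope.
Local Open Scope ring_scope.

(* The norm that MathComp-Analysis puts on 'rV[R]_n is the maximum norm; it is
   used below for its topology only, the Euclidean structure being dot. *)
Section Euclidean.
Variables (R : realType) (n : nat).
Implicit Types (u v x y : 'rV[R]_n) (U : {vspace 'rV[R]_n}).

Definition dot u v : R := (u *m v^T) 0 0.

Let dot_bilinear : sesquilinear.bilinear_for
  (GRing.Scale.Law.clone _ _ ( *%R ) _)
  (GRing.Scale.Law.clone _ _ (idfun \; *%R ) _) dot.
Proof.
split=> [u'|u] a x y; rewrite /dot.
  by rewrite mulmxDl -scalemxAl !mxE.
by rewrite linearP /= mulmxDr -scalemxAr !mxE.
Qed.

HB.instance Definition _ := sesquilinear.bilinear_isBilinear.Build R _ _ _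
  (GRing.Scale.Law.clone _ _ ( *%R ) _)
  (GRing.Scale.Law.clone _ _ (idfun \; *%R ) _) dot dot_bilinear.

Let dot_sym u v : dot u v = (-1) ^+ false * idfun (dot v u).
Proof. by rewrite mul1r /= /dot -[in LHS](trmxK u) -trmx_mul mxE. Qed.

HB.instance Definition _ :=
  sesquilinear.isHermitianSesquilinear.Build R _ false idfun dot dot_sym.

Definition enorm u : R := Num.sqrt (dot u u).

Definition perp U : {vspace 'rV[R]_n} := sesquilinear.orthov dot U.

Definition oproj U : 'End('rV[R]_n) := daddv_pi U (perp U).

Lemma mem_perpP U u : reflect {in U, forall v, dot u v = 0} (u \in perp U).
Proof. exact: sesquilinear.mem_orthovP. Qed.

(* The rows of E are an orthonormal basis of U, so that y |-> y *m E is a linear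
   isometry of R^k onto U. *)
Definition orthoframe k U (E : 'M[R]_(k, n)) :=
  E *m E^T = 1%:M /\ forall x, x \in U <-> exists y : 'rV[R]_k, x = y *m E.

End Euclidean.

Section Smooth.
Variables (R : realType) (W : normedModType R).
Implicit Types (f : W -> R) (s : seq W).

Definition iterD s f : W -> R := foldr (fun v g => 'D_v g) f s.

(* On an open set A this is C^\infty(A). *)
Definition smooth_on (A : set W) f :=
  forall s x, A x -> differentiable (iterD s f) x.

Definition smooth := smooth_on setT.

End Smooth.

Section Symbols.
Variables (R : realType) (k : nat).
Implicit Types (f : 'rV[R]_k -> R).

(* S^m_phg(R^k), one-step: f ~ \sum_j F_j with F_j homogeneous of degree m - j;
   iterD s is a derivative of order |s|. *)
Definition phg_symbol (m : int) f :=
  smooth f /\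
  exists F : nat -> 'rV[R]_k -> R,
    (forall j, smooth_on [set x | x != 0] (F j) /\
       forall (t : R) x, 0 < t -> x != 0 -> F j (t *: x) = t ^ (m - j%:Z) * F j x) /\
    forall N (s : seq 'rV[R]_k), exists C : R, forall x, 1 <= enorm x ->
      `| iterD s (fun y => f y - \sum_(j < N) F j y) x |
        <= C * enorm x ^ (m - N%:Z - (size s)%:Z).

End Symbols.

Section Lebesgue.
Variable R : realType.

Definition tuple_cons k (p : measurableTypeR R * k.-tuple (measurableTypeR R)) :
  k.+1.-tuple (measurableTypeR R) := [tuple of p.1 :: p.2].

Let measurable_tuple_cons k : measurable_fun setT (@tuple_cons k).
Proof. by apply: measurable_cons. Qed.

Definition lebesgue_cons k
    (m : {measure set (k.-tuple (measurableTypeR R)) -> \bar R}) :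
    set (k.+1.-tuple (measurableTypeR R)) -> \bar R :=
  pushforward (lebesgue_measure \x^ m)%E (@tuple_cons k).

HB.instance Definition _ k m := Measure.copy (@lebesgue_cons k m)
  (measure_function_pushforward__canonical__measure_function_Measure
     (lebesgue_measure \x^ m)%E (@measurable_tuple_cons k)).

(* Lebesgue measure on R^k, as an iterated product measure *)
Fixpoint lebn k : {measure set (k.-tuple (measurableTypeR R)) -> \bar R} :=
  match k with
  | 0 => \d_([tuple])
  | k'.+1 => lebesgue_cons (lebn k')
  end.

Definition row_of_tuple k (t : k.-tuple (measurableTypeR R)) : 'rV[R]_k :=
  \row_i (tnth t i : R).

End Lebesgue.

Section Schroedinger.
Variables (R : realType) (k : nat).
Implicit Types (u w W phi : 'rV[R]_k -> R) (psi chi : 'rV[R]_k -> R[i]).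

Definition L2 u := (u \o @row_of_tuple R k) \in Lfun (lebn R k) 2%:E.

Definition integral_Rn u : \bar R := \int[lebn R k]_t (u (row_of_tuple t))%:E.

Definition laplacian phi x : R :=
  - \sum_(i < k) 'D_(delta_mx 0 i) ('D_(delta_mx 0 i) phi) x.

Definition test_function phi :=
  smooth phi /\ compact (closure [set x | phi x != 0]).

Definition schroedinger_graph_real W u w :=
  [/\ L2 u, L2 w & forall phi, test_function phi ->
    integral_Rn (fun x => u x * (laplacian phi x + W x * phi x)) =
    integral_Rn (fun x => w x * phi x)].

(* The potentials W used here are bounded, so Delta + W is essentially
   self-adjoint on C_c^\infty(R^k): its self-adjoint realization on L^2(R^k; C)
   is the adjoint of its restriction to C_c^\infty, whose graph this is. As W is
   real-valued, real test functions suffice. *)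
Definition schroedinger_graph W psi chi :=
  schroedinger_graph_real W (fun x => complex.Re (psi x)) (fun x => complex.Re (chi x)) /\
  schroedinger_graph_real W (fun x => complex.Im (psi x)) (fun x => complex.Im (chi x)).

Definition L2_eigenvalue W (l : R) := exists psi,
  schroedinger_graph W psi (fun x => (l%:C)%C * psi x) /\
  ~ {ae lebn R k, forall t, psi (row_of_tuple t) = 0}.

End Schroedinger.

Record many_body (R : realType) (n : nat) := ManyBody {
  idx : finType;
  coll : idx -> {vspace 'rV[R]_n};
  coll_inj : injective coll;
  coll_cap : forall a b, exists c, coll c = (coll a :&: coll b)%VS;
  idx0 : idx;
  coll_idx0 : coll idx0 = fullv;
  idx1 : idx;
  coll_idx1 : coll idx1 = 0%VS;
  (* pot a is V_a; only its values on X^a = perp (coll a) are ever used *)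
  pot : idx -> 'rV[R]_n -> R;
  pot_idx0 : forall x, x \in perp (coll idx0) -> pot idx0 x = 0;
  pot_phg : forall a, exists k (E : 'M[R]_(k, n)),
    orthoframe (perp (coll a)) E /\ phg_symbol (-1) (fun y => pot a (y *m E)) }.

Section ManyBody.
Variables (R : realType) (n : nat) (H : many_body R n).
Local Notation I := (idx H).
Local Notation X := (@coll R n H).
Local Notation phase := ('rV[R]_n * 'rV[R]_n)%type.
Implicit Types (a b : I) (l t : R) (p q : phase) (J K : set R) (gamma : R -> phase).

Definition le_idx a b := (perp (X a) <= perp (X b))%VS.
Definition lt_idx a b := le_idx a b && (a != b).

(* eigenvalues of H^a, acting on L^2(X^a) = L^2(R^k) via an orthonormal basis *)
Definition spec_pp a : set R := [set l | exists k (E : 'M[R]_(k, n)),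
  orthoframe (perp (X a)) E /\
  L2_eigenvalue
    (fun y => \sum_(b | le_idx b a) pot b (oproj (perp (X b)) (y *m E))) l].

Definition thresholds : set R :=
  \bigcup_(b in [set b | lt_idx b (idx1 H)]) spec_pp b.

Definition face a : set 'rV[R]_n := [set w | dot w w = 1 /\ w \in X a].
Definition regular_face a : set 'rV[R]_n :=
  face a `\` \bigcup_(b in [set b | ~~ le_idx b a]) face b.

Definition cotangent : set phase := [set p | dot p.1 p.1 = 1].

(* Since the regular faces partition the sphere, \dot T is realized as the set of
   pairs (w, xi) with w in C'_a and xi in X_a for some a. *)
Definition proj p : phase :=
  if [pick a | `[< regular_face a p.1 >]] is Some a
  then (p.1, oproj (X a) p.2) else p.

(* the open sets of the quotient topology on \dot T = proj @` cotangent *)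
Definition dotT_open (O : set phase) :=
  exists W : set phase, open W /\ forall p, cotangent p -> (O (proj p) <-> W p).

Definition dotT_continuous J gamma := forall O, dotT_open O ->
  forall t, J t -> O (gamma t) -> \forall s \near t, J s -> O (gamma s).

Definition char_set b l : set phase :=
  [set p | [/\ face b p.1, p.2 \in X b & spec_pp b (l - dot p.2 p.2)]].

Definition dot_char_set l : set phase := \bigcup_b (proj @` char_set b l).

(* This is the field {}^{sc}H_g^b for every b: it is tangent to C_b x X_b. *)
Definition scH p : phase := (2 *: (p.2 - dot p.1 p.2 *: p.1), 0).

(* A smooth function on S^{n-1} x R^n is the restriction of a smooth function f on
   R^n x R^n; fpi is a function on \dot T. *)
Definition pi_invariant (f fpi : phase -> R) :=
  smooth f /\ forall p, cotangent p -> f p = fpi (proj p).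

(* When J contains no points on the relevant side of t, the filter is trivial and
   the liminf is +oo. *)
Definition dini J (F : set_system R) (h : R -> R) t : \bar R :=
  limf_einf (fun s => ((h s - h t) / (s - t))%:E) (within J F).

Definition gen_broken_bichar l J gamma :=
  [/\ forall t, J t -> dot_char_set l (gamma t),
      dotT_continuous J gamma &
      forall t a f fpi (F : set_system R), J t ->
        regular_face a (gamma t).1 -> (gamma t).2 \in X a ->
        pi_invariant f fpi -> F = t^'- \/ F = t^'+ ->
        (ereal_inf [set y | exists b p,
            [/\ face a `<=` face b, char_set b l p, proj p = gamma t &
                y = ('D_(scH p) f p)%:E]]
          <= dini J F (fpi \o gamma) t)%E].

Definition integral_curve K (c : R -> phase) := forall t, K t ->
  cotangent (c t) /\
  (fun s => (s - t)^-1 *: (c s - c t)) @ within K t^' --> scH (c t).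

Definition unbroken K gamma := exists c, integral_curve K c /\
  forall t, K t -> gamma t = proj (c t).

Definition globally_broken_relation := forall l gamma,
  gen_broken_bichar l setT gamma ->
  exists k (t : nat -> R),
    [/\ forall j, (j < k)%N -> t j < t j.+1,
        unbroken `]-oo, t 0]%classic gamma,
        unbroken `[t k, +oo[%classic gamma &
        forall j, (j < k)%N -> unbroken `[t j, t j.+1]%classic gamma].

(* the pieces of J lie before t 0, between t j and t j.+1, and after t m.-1 *)
Definition at_most_breaks J gamma (M : nat) := exists m (t : nat -> R),
  [/\ (m <= M)%N,
      forall j, (j < m)%N -> J (t j),
      forall i j, (i < j < m)%N -> t i < t j &
      forall j, (j <= m)%N ->
        unbroken [set s | [/\ J s, (0 < j)%N -> t j.-1 <= s & (j < m)%N -> s <= t j]]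
          gamma].

End ManyBody.

(* Main.v *)
(* Along a generalized broken bicharacteristic the index of the face containing omega
   determines the motion: near a point of C'_a the component xi_a is constant and, while
   the index is constant, xi is constant and omega follows the flow. It suffices to bound
   the number of times the index changes, by induction on a, for curves staying in the
   faces of index <= a. Write omega = omega_a + y with y in X^a, theta = y / |y| and let
   zeta = theta.xi be the radial momentum. Where y <> 0 the index is < a, so by induction
   the changes are locally finite, and on each piece, with kappa = |xi^a|^2,
     zeta' = 2 (kappa - zeta^2) / |y|,   |theta'| = 2 sqrt (kappa - zeta^2) / |y|.
   Thus zeta is nondecreasing and |d theta| = d zeta / sqrt (kappa - zeta^2). Since kappa
   takes at most #Lambda_1 values, for any lambda, the total length of theta is bounded by
   a constant depending on #Lambda_1 only. A Lebesgue number cuts the curve into boundedly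
   many pieces, on each of which the index is <= b for a fixed b < a. The set where y = 0
   is an interval on which the index is a. *)

Require Import Defs.
From HB Require Import structures.
From mathcomp Require Import all_boot all_order all_algebra.
From mathcomp Require Import all_classical all_reals all_analysis.
From mathcomp Require Import ring lra.

Set Implicit Arguments.
Unset Strict Implicit.
Unset Printing Implicit Defensive.

Import Order.TTheory GRing.Theory Num.Theory.
Import numFieldNormedType.Exports.

Local Open Scope classical_set_scope.
Local Open Scope ring_scope.

(** * Orthogonal projections *)

(** The definition bounds derivatives along [gamma] only from below, and xi jumps at a break, so
    omega.xi need not be differentiable there. Two-sided information comes from functions whose
    derivative is the same at every characteristic point over [gamma t]: the inequalities for f and
    -f then meet. Among them are v.omega and, up to a cutoff, v.xi for v in the current X_a. The
    one-sided inequality enters only through omega.xi: it shows that the energy carried by a piece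
    of constant index is exactly l - e for a threshold e, which is why kappa has finitely many
    values. Since kappa can change at every break, no single function of zeta measures the length of
    theta. One arc length function of zeta / sqrt kappa is attached to each possible value of kappa;
    all are nondecreasing in zeta, so their sum dominates the length whichever value is current.
    Each is bounded by an absolute constant, because only the ratio enters; this makes the bound
    independent of the energy. On the axis y = 0 neither zeta nor theta exists, and Gronwall for
    |y|^2 replaces them. *)

Section EuclideanSpace.
Variables (R : realType) (n : nat).
Implicit Types (u v w x y : 'rV[R]_n) (U V : {vspace 'rV[R]_n}).

Lemma dotE u v : dot u v = \sum_i u 0 i * v 0 i.
Proof. by rewrite /dot mxE; apply: eq_bigr => i _; rewrite mxE. Qed.

Lemma dotC u v : dot u v = dot v u.
Proof. by rewrite !dotE; apply: eq_bigr => i _; rewrite mulrC. Qed.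

Lemma dotDl u v w : dot (u + v) w = dot u w + dot v w.
Proof. by rewrite /dot mulmxDl mxE. Qed.

Lemma dotZl a u v : dot (a *: u) v = a * dot u v.
Proof. by rewrite /dot -scalemxAl mxE. Qed.

Lemma dotNl u v : dot (- u) v = - dot u v.
Proof. by rewrite -scaleN1r dotZl mulN1r. Qed.

Lemma dotBl u v w : dot (u - v) w = dot u w - dot v w.
Proof. by rewrite dotDl dotNl. Qed.

Lemma dotDr u v w : dot u (v + w) = dot u v + dot u w.
Proof. by rewrite dotC dotDl !(dotC u). Qed.

Lemma dotZr a u v : dot u (a *: v) = a * dot u v.
Proof. by rewrite dotC dotZl dotC. Qed.

Lemma dotNr u v : dot u (- v) = - dot u v.
Proof. by rewrite dotC dotNl dotC. Qed.

Lemma dotBr u v w : dot u (v - w) = dot u v - dot u w.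
Proof. by rewrite dotDr dotNr. Qed.

Lemma dot0l u : dot 0 u = 0.
Proof. by rewrite -(scale0r u) dotZl mul0r. Qed.

Lemma dot0r u : dot u 0 = 0.
Proof. by rewrite dotC dot0l. Qed.

Lemma dot_ge0 u : 0 <= dot u u.
Proof. by rewrite dotE sumr_ge0 // => i _; rewrite -expr2 sqr_ge0. Qed.

Lemma dot_eq0 u : (dot u u == 0) = (u == 0).
Proof.
apply/idP/idP => [|/eqP->]; last by rewrite dot0l.
rewrite dotE psumr_eq0; last by move=> i _; rewrite -expr2 sqr_ge0.
move=> /allP u0; apply/eqP/rowP => i; rewrite mxE.
by have /implyP/(_ isT) := u0 i (mem_index_enum i); rewrite mulf_eq0 orbb => /eqP.
Qed.

Lemma dot_gt0 u : (0 < dot u u) = (u != 0).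
Proof. by rewrite lt_neqAle eq_sym dot_eq0 dot_ge0 andbT. Qed.

Lemma dot_inj u v : (forall w, dot w u = dot w v) -> u = v.
Proof.
move=> uv; apply/eqP; rewrite -subr_eq0 -dot_eq0 dotBr.
by rewrite (uv (u - v)) subrr.
Qed.

Lemma dot_delta u i : dot (delta_mx 0 i) u = u 0 i.
Proof.
rewrite dotE (bigD1 i) //= mxE !eqxx mul1r big1 ?addr0 // => j ji.
by rewrite mxE eqxx (negbTE ji) mul0r.
Qed.

Lemma dot_CauchySchwarz u v : dot u v ^+ 2 <= dot u u * dot v v.
Proof.
have [->|v0] := eqVneq v 0; first by rewrite !dot0r expr0n mulr0.
have vv : 0 < dot v v by rewrite dot_gt0.
have := dot_ge0 (dot v v *: u - dot u v *: v).
rewrite !dotBl !dotBr !dotZl !dotZr (dotC v u).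
set a := dot u u; set b := dot u v; set c := dot v v => h.
have {}h : 0 <= c * (a * c - b ^+ 2) by move: h; congr (_ <= _); ring.
by rewrite pmulr_rge0 // subr_ge0 in h.
Qed.

(** The length of [x] is attained at the unit vector x / |x|. Estimates for the direction theta are
    proved one component [v] at a time; this turns them into a bound on a distance. *)
Lemma dot_sup_unit x (c : R) : 0 <= c ->
  (forall v, dot v v = 1 -> dot v x <= c) -> dot x x <= c ^+ 2.
Proof.
move=> c0 h; have [->|x0] := eqVneq x 0; first by rewrite dot0r sqr_ge0.
have xx : 0 < dot x x by rewrite dot_gt0.
have s0 : 0 < Num.sqrt (dot x x) by rewrite sqrtr_gt0.
have sE : Num.sqrt (dot x x) ^+ 2 = dot x x by rewrite sqr_sqrtr ?ltW.
set s := Num.sqrt _ in s0 sE.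
have vv : dot (s^-1 *: x) (s^-1 *: x) = 1.
  by rewrite dotZl dotZr -sE; field; rewrite gt_eqF.
have vx : dot (s^-1 *: x) x = s by rewrite dotZl -sE; field; rewrite gt_eqF.
by have := h _ vv; rewrite vx => sc; rewrite -sE ler_sqr ?nnegrE // ltW.
Qed.

Lemma capv_perp U : (U :&: perp U)%VS = 0%VS.
Proof.
apply/eqP; rewrite -subv0; apply/subvP => u.
rewrite memv_cap => /andP[uU /mem_perpP/(_ u uU)/eqP].
by rewrite dot_eq0 memv0.
Qed.

(** A dimension count: the kernel of x |-> (x.u_i), for a basis u_i of [U], lies in [perp U] and has
    codimension at most dim U. *)
Lemma addv_perp U : (U + perp U)%VS = fullv.
Proof.
apply/eqP; rewrite eqEdim subvf /= dimv_disjoint_sum ?capv_perp //.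
pose B : 'M[R]_(\dim U, n) := \matrix_i (vbasis U)`_i.
pose L := linfun (mulmxr B^T : 'rV[R]_n -> 'rV[R]_(\dim U)).
have := limg_ker_dim L fullv; rewrite capfv => <-.
have kerL : (lker L <= perp U)%VS.
  apply/subvP => x; rewrite memv_ker lfunE /= => /eqP xB.
  apply/mem_perpP => v /coord_vbasis ->.
  apply: (big_ind (fun y => dot x y = 0)) => [|y z y0 z0|i _].
  - exact: dot0r.
  - by rewrite dotDr y0 z0 addr0.
  rewrite dotZr.
  suff -> : dot x (vbasis U)`_i = (x *m B^T) 0 i by rewrite xB mxE mulr0.
  by rewrite dotE mxE; apply: eq_bigr => j _; rewrite !mxE.
rewrite addnC leq_add //; last exact: dimvS.
apply: (leq_trans (dimvS (subvf _))).
by rewrite dimvf /dim /= mul1n.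
Qed.

Lemma oproj_mem U x : oproj U x \in U.
Proof. exact: memv_pi. Qed.

Lemma sub_oproj_perp U x : x - oproj U x \in perp U.
Proof.
have xU : x \in (U + perp U)%VS by rewrite addv_perp memvf.
by rewrite -{1}(daddv_pi_add (capv_perp U) xU) addrC addKr memv_pi.
Qed.

Lemma oprojP U x p : p \in U -> x - p \in perp U -> oproj U x = p.
Proof.
move=> pU xp; apply/eqP; rewrite -subr_eq0 -memv0 -(capv_perp U) memv_cap.
rewrite rpredB ?oproj_mem //=.
have -> : oproj U x - p = (x - p) - (x - oproj U x).
  by rewrite opprB [RHS]addrC addrA subrK.
by rewrite rpredB // sub_oproj_perp.
Qed.

Lemma oproj_id U x : x \in U -> oproj U x = x.
Proof. by move=> xU; apply: oprojP; rewrite // subrr mem0v. Qed.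

Lemma dot_oproj U v x : v \in U -> dot v (oproj U x) = dot v x.
Proof.
move=> vU; apply/eqP; rewrite eq_sym -subr_eq0 -dotBr dotC.
by have /mem_perpP/(_ v vU)-> := sub_oproj_perp U x.
Qed.

Lemma dot_oprojC U v x : dot (oproj U v) x = dot v (oproj U x).
Proof.
rewrite -(dot_oproj x (oproj_mem U v)) dotC.
by rewrite (dot_oproj v (oproj_mem U x)) dotC.
Qed.

Lemma dot_sub_oproj U x :
  dot (x - oproj U x) (x - oproj U x) = dot x x - dot (oproj U x) (oproj U x).
Proof.
rewrite !dotBl !dotBr !(dotC _ (oproj U x)).
by rewrite (dot_oproj x (oproj_mem U x)) subrr subr0.
Qed.

Lemma dot_oproj_le U x : dot (oproj U x) (oproj U x) <= dot x x.
Proof. by rewrite -subr_ge0 -dot_sub_oproj dot_ge0. Qed.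

Lemma sub_perp U V : (perp V <= perp U)%VS = (U <= V)%VS.
Proof.
apply/idP/idP => /subvP UV; apply/subvP => x xU; last first.
  by apply/mem_perpP => v /UV; move: v; apply/mem_perpP.
suff -> : x = oproj V x by apply: oproj_mem.
apply/eqP; rewrite -subr_eq0 -dot_eq0; apply/eqP.
rewrite dotBr.
have /mem_perpP/(_ _ (oproj_mem V x))-> := sub_oproj_perp V x.
by have /UV/mem_perpP/(_ x xU)-> := sub_oproj_perp V x; rewrite subrr.
Qed.

End EuclideanSpace.

(** * Polynomial test functions *)

Section PolynomialTestFunctions.
Variables (R : realType) (V : normedModType R).
Implicit Types (f g L : V -> R) (x v : V).

(* The closure of the linear forms under the ring operations; the second
   constructor asks only for a constant differential. *)
Inductive polyfun : (V -> R) -> Prop :=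
| polyfun_cst c : polyfun (cst c)
| polyfun_lin L : (forall x, differentiable L x) ->
    (forall v, exists c, forall x, 'D_v L x = c) -> polyfun L
| polyfun_add f g : polyfun f -> polyfun g -> polyfun (fun x => f x + g x)
| polyfun_mul f g : polyfun f -> polyfun g -> polyfun (fun x => f x * g x).

Lemma polyfun_differentiable f x : polyfun f -> differentiable f x.
Proof.
elim=> {f} [c|L dL _|f g _ df _ dg|f g _ df _ dg] //.
- exact: differentiableD.
- exact: differentiableM.
Qed.

Lemma polyfun_derive f v : polyfun f -> polyfun ('D_v f).
Proof.
elim=> {f} [c|L dL DL|f g pf Df pg Dg|f g pf Df pg Dg].
- have -> : 'D_v (cst c : V -> R) = cst 0 by apply/funext => x; rewrite derive_cst.
  exact: polyfun_cst.
- have [c Lc] := DL v.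
  have -> : 'D_v L = cst c by apply/funext => x; rewrite Lc.
  exact: polyfun_cst.
- have -> : 'D_v (fun x => f x + g x) = (fun x => 'D_v f x + 'D_v g x).
    by apply/funext => x; rewrite deriveD //;
      apply/diff_derivable/polyfun_differentiable.
  exact: polyfun_add.
- have -> : 'D_v (fun x => f x * g x) = (fun x => f x * 'D_v g x + g x * 'D_v f x).
    by apply/funext => x; rewrite deriveM //;
      apply/diff_derivable/polyfun_differentiable.
  by apply: polyfun_add; apply: polyfun_mul.
Qed.

Lemma polyfun_smooth f : polyfun f -> smooth f.
Proof.
move=> pf s x _; apply: polyfun_differentiable.
by elim: s => [//|v s IH] /=; apply: polyfun_derive.
Qed.

Lemma polyfun_continuous f : polyfun f -> continuous f.
Proof.
by move=> pf x; apply: differentiable_continuous; exact: polyfun_differentiable.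
Qed.

Lemma polyfun_sum (I : Type) (r : seq I) (P : pred I) (F : I -> V -> R) :
  (forall i, P i -> polyfun (F i)) -> polyfun (fun x => \sum_(i <- r | P i) F i x).
Proof.
move=> PF; elim: r => [|i r IH].
  by under eq_fun do rewrite big_nil; exact: polyfun_cst.
under eq_fun do rewrite big_cons; case: (boolP (P i)) => Pi //.
by apply: polyfun_add; [exact: PF|exact: IH].
Qed.

Lemma polyfun_prod (I : Type) (r : seq I) (P : pred I) (F : I -> V -> R) :
  (forall i, P i -> polyfun (F i)) -> polyfun (fun x => \prod_(i <- r | P i) F i x).
Proof.
move=> PF; elim: r => [|i r IH].
  by under eq_fun do rewrite big_nil; exact: polyfun_cst.
under eq_fun do rewrite big_cons; case: (boolP (P i)) => Pi //.
by apply: polyfun_mul; [exact: PF|exact: IH].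
Qed.

Lemma derive_linear_form L x v : (forall a y z, L (a *: y + z) = a * L y + L z) ->
  'D_v L x = L v.
Proof.
move=> linL; apply: cvg_lim => //; apply: cvg_near_cst.
near=> h; rewrite /= linL addrK scalerA mulVf ?scale1r //.
by near: h; exact: nbhs_dnbhs_neq.
Unshelve. all: by end_near. Qed.

Lemma polyfun_linear_form L : (forall a y z, L (a *: y + z) = a * L y + L z) ->
  (forall x, differentiable L x) -> polyfun L.
Proof.
by move=> linL dL; apply: polyfun_lin => // v; exists (L v) => x; exact: derive_linear_form.
Qed.

End PolynomialTestFunctions.

Section PhaseSpacePolynomials.
Variables (R : realType) (n : nat).
Local Notation phase := ('rV[R]_n * 'rV[R]_n)%type.
Implicit Types (u v : 'rV[R]_n) (p d : phase) (U : {vspace 'rV[R]_n}).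

Lemma polyfun_coord1 (i : 'I_n) : polyfun (fun p : phase => p.1 0 i).
Proof.
apply: polyfun_linear_form => [a y z|x]; first by rewrite !mxE.
apply: (@differentiable_comp _ _ _ _ fst (fun w : 'rV[R]_n => w 0 i)).
  by apply: linear_differentiable => z; exact: cvg_fst.
exact: differentiable_coord.
Qed.

Lemma polyfun_coord2 (i : 'I_n) : polyfun (fun p : phase => p.2 0 i).
Proof.
apply: polyfun_linear_form => [a y z|x]; first by rewrite !mxE.
apply: (@differentiable_comp _ _ _ _ snd (fun w : 'rV[R]_n => w 0 i)).
  by apply: linear_differentiable => z; exact: cvg_snd.
exact: differentiable_coord.
Qed.

Lemma polyfun_dot1 v : polyfun (fun p : phase => dot v p.1).
Proof.
under eq_fun do rewrite dotE.
apply: polyfun_sum => i _; apply: polyfun_mul; first exact: polyfun_cst.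
exact: polyfun_coord1.
Qed.

Lemma polyfun_dot2 v : polyfun (fun p : phase => dot v p.2).
Proof.
under eq_fun do rewrite dotE.
apply: polyfun_sum => i _; apply: polyfun_mul; first exact: polyfun_cst.
exact: polyfun_coord2.
Qed.

Lemma polyfun_dot12 : polyfun (fun p : phase => dot p.1 p.2).
Proof.
under eq_fun do rewrite dotE.
apply: polyfun_sum => i _; apply: polyfun_mul.
- exact: polyfun_coord1.
- exact: polyfun_coord2.
Qed.

Lemma derive_dot1 v p d : 'D_d (fun p : phase => dot v p.1) p = dot v d.1.
Proof.
rewrite (@derive_linear_form _ _ (fun p : phase => dot v p.1)) // => a y z.
by rewrite dotDr dotZr.
Qed.

Lemma derive_dot2 v p d : 'D_d (fun p : phase => dot v p.2) p = dot v d.2.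
Proof.
rewrite (@derive_linear_form _ _ (fun p : phase => dot v p.2)) // => a y z.
by rewrite dotDr dotZr.
Qed.

Lemma derive_dot12 p d :
  'D_d (fun p : phase => dot p.1 p.2) p = dot d.1 p.2 + dot p.1 d.2.
Proof.
have -> : (fun p : phase => dot p.1 p.2) =
    \sum_(i < n) (fun p : phase => p.1 0 i * p.2 0 i).
  by apply/funext => q; rewrite fct_sumE dotE.
rewrite derive_sum => [|i]; last first.
  apply/diff_derivable/polyfun_differentiable.
  by apply: polyfun_mul; [exact: polyfun_coord1|exact: polyfun_coord2].
rewrite !dotE -big_split /=; apply: eq_bigr => i _.
rewrite deriveM; [|apply/diff_derivable/polyfun_differentiable..].
- rewrite (@derive_linear_form _ _ (fun p : phase => p.2 0 i)); last by move=> *; rewrite !mxE.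
  rewrite (@derive_linear_form _ _ (fun p : phase => p.1 0 i)); last by move=> *; rewrite !mxE.
  by rewrite addrC; congr (_ + _); rewrite mulrC.
- exact: polyfun_coord1.
- exact: polyfun_coord2.
Qed.

Definition sqdist U v : R := dot (v - oproj U v) (v - oproj U v).

Lemma sqdist_ge0 U v : 0 <= sqdist U v.
Proof. exact: dot_ge0. Qed.

Lemma sqdist_eq0 U v : (sqdist U v == 0) = (v \in U).
Proof.
rewrite dot_eq0 subr_eq0; apply/eqP/idP => [->|vU]; first exact: oproj_mem.
by rewrite oproj_id.
Qed.

Lemma sqdistE U v :
  sqdist U v = \sum_i dot (delta_mx 0 i - oproj U (delta_mx 0 i)) v ^+ 2.
Proof.
rewrite /sqdist dotE; apply: eq_bigr => i _.
by rewrite dotBl dot_oprojC -dotBr dot_delta expr2.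
Qed.

Lemma polyfun_sqdist U : polyfun (fun p : phase => sqdist U p.1).
Proof.
under eq_fun do rewrite sqdistE.
apply: polyfun_sum => i _; under eq_fun do rewrite expr2.
by apply: polyfun_mul; exact: polyfun_dot1.
Qed.

End PhaseSpacePolynomials.

(** * Calculus *)

Section Calculus.
Variable R : realType.
Implicit Types (f g h : R -> R) (a b c t x : R) (J : set R).

Lemma is_derive_addf f g t a b : is_derive t 1 f a -> is_derive t 1 g b ->
  is_derive t 1 (fun x => f x + g x) (a + b).
Proof. exact: is_deriveD. Qed.

Lemma is_derive_subf f g t a b : is_derive t 1 f a -> is_derive t 1 g b ->
  is_derive t 1 (fun x => f x - g x) (a - b).
Proof. exact: is_deriveB. Qed.

Lemma is_derive_mulf f g t a b : is_derive t 1 f a -> is_derive t 1 g b ->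
  is_derive t 1 (fun x => f x * g x) (a * g t + f t * b).
Proof.
move=> fa gb; apply: is_derive_eq (is_deriveM fa gb) _.
by rewrite addrC mulrC.
Qed.

Lemma is_derive_scalef f c t a : is_derive t 1 f a ->
  is_derive t 1 (fun x => c * f x) (c * a).
Proof. by move=> fa; apply: is_derive_eq (is_deriveZ c fa) _. Qed.

Lemma is_derive_constf c t : is_derive t 1 (fun _ : R => c) 0.
Proof. exact: is_derive_cst. Qed.

Lemma is_derive_sqrtf f t a : 0 < f t -> is_derive t 1 f a ->
  is_derive t 1 (fun x => Num.sqrt (f x)) (a / (2 * Num.sqrt (f t))).
Proof.
move=> ft fa; have sf := is_derive1_sqrt ft.
by apply: is_derive_eq (is_derive1_comp sf fa) _; rewrite mulrC.
Qed.

Lemma is_derive_divf f g t a b : g t != 0 -> is_derive t 1 f a ->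
  is_derive t 1 g b ->
  is_derive t 1 (fun x => f x / g x) ((a * g t - f t * b) / g t ^+ 2).
Proof.
move=> gt0 fa gb; have gV := is_deriveV gt0 gb.
apply: is_derive_eq (is_derive_mulf fa gV) _.
by rewrite /GRing.scale /=; field.
Qed.

Lemma is_derive_sumf n (F : 'I_n -> R -> R) (d : 'I_n -> R) t :
  (forall i, is_derive t 1 (F i) (d i)) ->
  is_derive t 1 (fun x => \sum_i F i x) (\sum_i d i).
Proof.
move=> Fd; have := is_derive_sum Fd.
by congr (is_derive _ _ _ _); apply/funext => x; rewrite fct_sumE.
Qed.

Lemma derive_ge0_le f (df : R -> R) a b : a <= b ->
  {within `[a, b], continuous f} ->
  (forall x, a < x < b -> is_derive x 1 f (df x)) ->
  (forall x, a < x < b -> 0 <= df x) -> f a <= f b.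
Proof.
rewrite le_eqVlt => /predU1P[-> //|ab] cf fd d0.
have fd' x : x \in `]a, b[ -> is_derive x 1 f (df x).
  by rewrite in_itv /=; exact: fd.
have [x xab E] := MVT ab fd' cf.
rewrite in_itv /= in xab; rewrite -subr_ge0 E mulr_ge0 ?d0 //.
by rewrite subr_ge0 ltW.
Qed.

Lemma derive0_eq f (df : R -> R) a b : a <= b ->
  {within `[a, b], continuous f} ->
  (forall x, a < x < b -> is_derive x 1 f (df x)) ->
  (forall x, a < x < b -> df x = 0) -> f a = f b.
Proof.
rewrite le_eqVlt => /predU1P[-> //|ab] cf fd d0.
have fd' x : x \in `]a, b[ -> is_derive x 1 f (df x).
  by rewrite in_itv /=; exact: fd.
have [x xab E] := MVT ab fd' cf.
rewrite in_itv /= in xab; apply/esym/eqP.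
by rewrite -subr_eq0 E d0 // mul0r.
Qed.

Lemma withinM f g J : {within J, continuous f} -> {within J, continuous g} ->
  {within J, continuous (fun x => f x * g x)}.
Proof. by move=> cf cg x; apply: continuousM; [exact: cf|exact: cg]. Qed.

Lemma withinD f g J : {within J, continuous f} -> {within J, continuous g} ->
  {within J, continuous (fun x => f x + g x)}.
Proof. by move=> cf cg x; apply: continuousD; [exact: cf|exact: cg]. Qed.

Lemma withinB f g J : {within J, continuous f} -> {within J, continuous g} ->
  {within J, continuous (fun x => f x - g x)}.
Proof. by move=> cf cg x; apply: continuousB; [exact: cf|exact: cg]. Qed.

Lemma within_cst c J : {within J, continuous (fun _ : R => c)}.
Proof. by move=> x; exact: cst_continuous. Qed.

Lemma within_div f g J : (forall x, J x -> g x != 0) ->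
  {within J, continuous f} -> {within J, continuous g} ->
  {within J, continuous (fun x => f x / g x)}.
Proof.
move=> g0 /subspace_continuousP cf /subspace_continuousP cg.
apply/subspace_continuousP => x Jx; apply: cvgM; first exact: cf.
by apply: cvgV; [exact: g0|exact: cg].
Qed.

Lemma within_sqrt f J : {within J, continuous f} ->
  {within J, continuous (fun x => Num.sqrt (f x))}.
Proof.
move=> cf x; apply: continuous_comp; [exact: cf|exact: sqrt_continuous].
Qed.

Lemma within_sum n (F : 'I_n -> R -> R) J :
  (forall i, {within J, continuous (F i)}) ->
  {within J, continuous (fun x => \sum_i F i x)}.
Proof.
move=> cF; elim: (index_enum _) => [|i r IH].
  by under eq_fun do rewrite big_nil; exact: within_cst.
by under eq_fun do rewrite big_cons; apply: withinD; [exact: cF|exact: IH].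
Qed.

Lemma is_derive_expRM c t :
  is_derive t 1 (fun x => expR (c * x)) (c * expR (c * t)).
Proof.
have cd : is_derive t 1 (fun x => c * x) c.
  apply: is_derive_eq (is_derive_scalef c (is_derive_id t 1)) _.
  exact: mulr1.
by apply: is_derive_eq (is_derive1_comp (is_derive_expR (c * t)) cd) _; rewrite mulrC.
Qed.

(** The function f(x) exp(-C x) is nonincreasing, so a nonpositive initial value persists. *)
Lemma gronwall_le0 f (df : R -> R) (C a b : R) : a <= b ->
  {within `[a, b], continuous f} ->
  (forall x, a < x < b -> is_derive x 1 f (df x)) ->
  (forall x, a < x < b -> df x <= C * f x) -> f a <= 0 -> f b <= 0.
Proof.
move=> ab cf fd dC fa.
pose e x := expR (- C * x).
have ed x : is_derive x 1 e (- C * expR (- C * x)).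
  exact: is_derive_expRM.
have ce : {within `[a, b], continuous e}.
  apply: continuous_subspaceT => x; apply: differentiable_continuous.
  by apply/derivable1_diffP; have [] := ed x.
have: - f a * e a <= - f b * e b.
  apply: (@derive_ge0_le (fun x => - f x * e x)
    (fun x => - df x * e x + - f x * (- C * e x))) => //.
  - apply: withinM => // x; apply: continuousN; exact: cf.
  - by move=> x xab; have fx := is_deriveN (fd x xab); exact: is_derive_mulf fx (ed x).
  - move=> x xab; have e0 : 0 < e x by exact: expR_gt0.
    have -> : - df x * e x + - f x * (- C * e x) = (C * f x - df x) * e x by ring.
    by rewrite mulr_ge0 ?subr_ge0 ?dC // ltW.
rewrite !mulNr lerN2 => h; have eb0 : 0 < e b by exact: expR_gt0.
rewrite -(pmulr_lle0 _ eb0); apply: le_trans h _.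
by rewrite pmulr_lle0 // expR_gt0.
Qed.

(** Gronwall with time reversed: f(x) exp(C x) is nondecreasing. *)
Lemma gronwall_back_le0 f (df : R -> R) (C a b : R) : a <= b ->
  {within `[a, b], continuous f} ->
  (forall x, a < x < b -> is_derive x 1 f (df x)) ->
  (forall x, a < x < b -> - (C * f x) <= df x) -> f b <= 0 -> f a <= 0.
Proof.
move=> ab cf fd dC fb.
pose e x := expR (C * x).
have ed x : is_derive x 1 e (C * expR (C * x)).
  exact: is_derive_expRM.
have ce : {within `[a, b], continuous e}.
  apply: continuous_subspaceT => x; apply: differentiable_continuous.
  by apply/derivable1_diffP; have [] := ed x.
have: f a * e a <= f b * e b.
  apply: (@derive_ge0_le (fun x => f x * e x)
    (fun x => df x * e x + f x * (C * e x))) => //.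
  - exact: withinM.
  - by move=> x xab; exact: is_derive_mulf (fd x xab) (ed x).
  - move=> x xab; have e0 : 0 < e x by exact: expR_gt0.
    have -> : df x * e x + f x * (C * e x) = (df x - - (C * f x)) * e x by ring.
    by rewrite mulr_ge0 ?subr_ge0 ?dC // ltW.
move=> h; have ea0 : 0 < e a by exact: expR_gt0.
rewrite -(pmulr_lle0 _ ea0); apply: le_trans h _.
by rewrite pmulr_lle0 // expR_gt0.
Qed.

(** The supremum of the [t] with [D a t] has this property itself and cannot be less than [b]. The
    local hypothesis concerns each side of [t] separately, so that [t] may be a break. *)
Lemma local_to_global (D : R -> R -> Prop) a b : a <= b ->
  (forall x y z, a <= x -> x <= y -> y <= z -> z <= b -> D x y -> D y z -> D x z) ->
  (forall t, a <= t <= b -> exists2 e, 0 < e & forall u, a <= u <= b ->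
     `|u - t| < e -> (u <= t -> D u t) /\ (t <= u -> D t u)) ->
  D a b.
Proof.
move=> ab trD locD.
pose S := [set t | a <= t <= b /\ D a t].
have Sa : S a.
  split; first by rewrite lexx.
  have [|e e0 /(_ a)] := locD a; first by rewrite lexx.
  by rewrite lexx subrr normr0 => /(_ ab e0)[+ _]; exact.
have Sb : ubound S b by move=> t [/andP[]].
have supS : has_sup S by split; [exists a|exists b].
pose c := sup S.
have ubS x : S x -> x <= c by move=> Sx; exact: (ub_le_sup supS.2 Sx).
have ac : a <= c by exact: ubS.
have cb : c <= b by apply: ge_sup Sb; exists a.
have [|e e0 De] := locD c; first by rewrite ac.
have [s [sab Das] cs] := sup_adherent e0 supS.
have sc : s <= c by apply: ubS; split.
have Dac : D a c.
  have /andP[as_ sb] := sab.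
  apply: (trD a s c) => //; apply: (De s sab _).1 => //.
  by rewrite ler0_norm ?subr_le0 // opprB ltrBlDr -ltrBlDl.
have [|cltb] := eqVneq c b; first by move=> <-.
have {}cltb : c < b by rewrite lt_neqAle cltb.
pose u := Num.min b (c + e / 2).
have cu : c < u by rewrite lt_min cltb ltrDl divr_gt0.
have ub : u <= b by rewrite ge_min lexx.
have uc : u <= c + e / 2 by rewrite ge_min lexx orbT.
have uab : a <= u <= b by rewrite ub andbT (le_trans ac) // ltW.
have Su : S u.
  split=> //; apply: (trD a c u) => //; first exact: ltW.
  apply: (De u uab _).2; last exact: ltW.
  rewrite gtr0_norm ?subr_gt0 //; lra.
by have := ubS u Su; rewrite leNgt cu.
Qed.

Lemma interval_near J a b t : is_interval J -> J a -> J b -> a < t < b ->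
  \forall s \near t, J s.
Proof.
move=> iJ Ja Jb tab; have : \forall s \near t, s \in `]a, b[.
  by apply: near_in_itvoo; rewrite in_itv.
apply: filterS => s; rewrite in_itv /= => /andP[/ltW as_ /ltW sb].
by apply: iJ Ja Jb _ _; rewrite as_ sb.
Qed.

Lemma segment_sub J a b : is_interval J -> J a -> J b -> `[a, b] `<=` J.
Proof. by move=> iJ Ja Jb x /=; rewrite in_itv /= => xab; exact: iJ xab. Qed.

End Calculus.

(** * Difference quotients relative to an interval *)

Section Quotients.
Variables (R : realType) (J : set R) (h : R -> R) (t : R).
Implicit Types (l m : R).

(** The derivative of [h] at [t] relative to [J]: one-sided at an endpoint of [J], the usual
    derivative at an interior point, vacuous at an isolated point. *)
Definition quot_within l := forall e, 0 < e -> \forall s \near t^',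
  J s -> `|(h s - h t) / (s - t) - l| < e.

Lemma dini_gt (F : set_system R) m : Filter F ->
  (m%:E <= dini J F h t)%E ->
  forall e, 0 < e -> \forall s \near F, J s -> m - e < (h s - h t) / (s - t).
Proof.
move=> FF mD e e0.
have : ((m - e)%:E < dini J F h t)%E.
  by apply: lt_le_trans mD; rewrite lte_fin ltrBlDr ltrDl.
rewrite /dini limf_einfE => /ereal_sup_gt[_ [V VF <-] mV].
rewrite /within /= in VF; apply: filterS VF => s Vs Js; rewrite -lte_fin; apply: lt_le_trans mV _.
by apply: ereal_inf_lbound; exists s => //; exact: Vs.
Qed.

Lemma dini_two_sided_gt m : (m%:E <= dini J t^'- h t)%E ->
  (m%:E <= dini J t^'+ h t)%E ->
  forall e, 0 < e -> \forall s \near t^', J s -> m - e < (h s - h t) / (s - t).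
Proof.
move=> /dini_gt mL /dini_gt mR e e0.
pose P s := J s -> m - e < (h s - h t) / (s - t).
have L : \forall s \near t, s < t -> P s := mL _ e0.
have Rr : \forall s \near t, t < s -> P s := mR _ e0.
suff: \forall s \near t, s != t -> P s by [].
apply: filterS2 L Rr => s Ls Rs st; have [lt|gt|E] := ltgtP s t.
- exact: Ls.
- exact: Rs.
- by rewrite E eqxx in st.
Qed.

Lemma quot_within_ball l e : 0 < e -> quot_within l ->
  exists2 d, 0 < d & forall s, J s -> `|s - t| < d ->
    `|h s - h t - l * (s - t)| <= e * `|s - t|.
Proof.
move=> e0 /(_ _ e0); move=> qe.
have {qe}/nbhs_ballP[d d0 Hd] : \forall s \near t, s != t -> J s ->
  `|(h s - h t) / (s - t) - l| < e := qe.
exists d => // s Js std; have {}std : ball t d s by rewrite /ball /= distrC.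
have [->|st] := eqVneq s t; first by rewrite !subrr mulr0 subrr normr0 mulr0.
have st0 : 0 < `|s - t| by rewrite normr_gt0 subr_eq0.
have := Hd s std st Js.
have -> : (h s - h t) / (s - t) - l = (h s - h t - l * (s - t)) / (s - t).
  by field; rewrite subr_eq0.
by rewrite normrM normfV ltr_pdivrMr // => /ltW.
Qed.

Lemma quot_within_cvg l : quot_within l -> h @ within J (nbhs t) --> h t.
Proof.
move=> qw; have [d d0 Hd] := quot_within_ball ltr01 qw.
apply/cvgrPdist_lt => e e0; apply/nbhs_ballP.
have l0 : 0 < 1 + `|l| by rewrite ltr_pwDl.
exists (Num.min d (e / (1 + `|l|))) => /=; first by rewrite lt_min d0 divr_gt0.
move=> s; rewrite /ball /= distrC lt_min => /andP[sd]; rewrite ltr_pdivlMr // => se Js.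
have H := Hd s Js sd; rewrite distrC.
have -> : h s - h t = h s - h t - l * (s - t) + l * (s - t) by rewrite subrK.
apply: le_lt_trans (ler_normD _ _) _; rewrite normrM.
by apply: le_lt_trans se; rewrite [leRHS]mulrDr mulr1 [`|l| * _]mulrC lerD2r -[leRHS]mul1r.
Qed.

Lemma quot_within_derive l : (\forall s \near t, J s) -> quot_within l ->
  is_derive t 1 h l.
Proof.
move=> nJ qw.
have H : (fun k => k^-1 *: (h (k *: 1 + t) - h t)) @ 0^' --> l.
  apply/cvgrPdist_lt => e e0.
  have qe : \forall s \near t, s != t -> J s ->
    `|(h s - h t) / (s - t) - l| < e := qw e e0.
  have /nbhs_ballP[d d0 Hd] := qe.
  move/nbhs_ballP : nJ => [d' d'0 Hd'].
  near=> k; have k0 : k != 0 by near: k; exact: nbhs_dnbhs_neq.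
  have kd : `|k| < d by near: k; exact: dnbhs0_lt.
  have kd' : `|k| < d' by near: k; exact: dnbhs0_lt.
  have kE : k *: 1 + t - t = k by rewrite addrK /GRing.scale /= mulr1.
  rewrite distrC [_ *: (_ - _)]mulrC.
  have := Hd (k *: 1 + t); rewrite kE; apply.
  - by rewrite /ball /= distrC kE.
  - by rewrite -subr_eq0 kE.
  - by apply: Hd'; rewrite /ball /= distrC kE.
have dh : derivable h t 1 by apply/cvg_ex; exists l.
by apply: DeriveDef => //; apply: cvg_lim.
Unshelve. all: by end_near. Qed.

Lemma is_derive_quot_within l : is_derive t 1 h l -> quot_within l.
Proof.
move=> dh e e0.
have /cvg_ex[l' hl'] : derivable h t 1 by case: dh.
have ll' : l = l' by case: dh => _ <-; exact: cvg_lim hl'.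
rewrite -{}ll' in hl'.
move/cvgrPdist_lt : hl' => /(_ e e0) qe.
have {qe}/nbhs_ballP[d d0 Hd] : \forall k \near (0 : R), k != 0 ->
  `|l - k^-1 *: (h (k *: 1 + t) - h t)| < e := qe.
suff: \forall s \near t, s != t -> J s -> `|(h s - h t) / (s - t) - l| < e by [].
apply/nbhs_ballP; exists d => // s; rewrite /ball /= => std st _.
have := Hd (s - t); rewrite /ball /= sub0r normrN distrC => /(_ std).
rewrite subr_eq0 => /(_ st).
by rewrite /GRing.scale /= mulr1 subrK distrC mulrC.
Qed.

End Quotients.

(** * Counting the changes of an index *)

Section Breaks.
Variables (R : realType) (T : Type) (A : R -> T).
Implicit Types (J K : set R) (s : seq R).

(** Only closed intervals without a point of [s] are tested, so the value of [A] at a break itself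
    is free. The list may be unsorted and may contain points outside [J]. *)
Definition breaks_in J s := forall t u, J t -> J u -> t <= u ->
  (forall x, x \in s -> ~~ (t <= x <= u)) -> A t = A u.

(** Each level set of [k] contributes its own breaks and its supremum: an interval that leaves the
    level set of its left end contains that supremum. *)
Lemma breaks_in_partition J (k : R -> nat) (N M : nat) :
  (forall t, J t -> (k t < N)%N) ->
  (forall t u, J t -> J u -> t <= u -> (k t <= k u)%N) ->
  (forall i, (i < N)%N -> exists s, (size s <= M)%N /\ breaks_in (J `&` [set t | k t = i]) s) ->
  exists s, (size s <= N * M.+1)%N /\ breaks_in J s.
Proof.
move=> kN kmono kM.
have [S SM] := fin_all_exists (fun i : 'I_N => kM i (ltn_ord i)).
pose K i := J `&` [set t | k t = i].
exists (flatten [seq sup (K i) :: S i | i : 'I_N]); split.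
  rewrite size_flatten /shape -map_comp sumnE big_map big_enum /=.
  rewrite -[X in (X * _)%N]card_ord -sum_nat_const leq_sum // => i _ /=.
  by rewrite ltnS (SM i).1.
move=> t u Jt Ju tu noS.
pose i := Ordinal (kN t Jt).
have noSi x : x \in sup (K i) :: S i -> ~~ (t <= x <= u).
  move=> xi; apply: noS; apply/flattenP; exists (sup (K i) :: S i) => //.
  by apply/mapP; exists i; rewrite // mem_enum.
have [kE|kNE] := eqVneq (k t) (k u).
  apply: (SM i).2 => // x xS; apply: noSi; by rewrite in_cons xS orbT.
have ktu : (k t < k u)%N by rewrite ltn_neqAle kNE kmono.
have ubK : ubound (K i) u.
  move=> x [Jx kx]; rewrite leNgt; apply/negP => ux.
  by have := kmono _ _ Ju Jx (ltW ux); rewrite kx leqNgt ktu.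
have Kt : K i t by split.
have := noSi (sup (K i)); rewrite mem_head => /(_ isT)/negP; case.
have supK : has_ubound (K i) by exists u.
rewrite (ub_le_sup supK Kt) /=.
by apply: ge_sup => //; exists t.
Qed.

End Breaks.

(** * Generalized broken bicharacteristics *)

Section RegularFaces.
Variables (R : realType) (n : nat) (H : many_body R n).
Local Notation X := (@coll R n H).
Local Notation phase := ('rV[R]_n * 'rV[R]_n)%type.
Implicit Types (a b : idx H) (v w : 'rV[R]_n) (p : phase).

Lemma le_idxE a b : le_idx a b = (X b <= X a)%VS.
Proof. exact: sub_perp. Qed.

(** A member of least dimension containing [w] is the least one, since its intersection with any
    other such member is again in the collection. *)
Lemma ex_minimal_coll w :
  exists a, w \in X a /\ forall b, w \in X b -> (X a <= X b)%VS.
Proof.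
have w0 : w \in X (idx0 H) by rewrite coll_idx0 memvf.
case: (@arg_minnP _ (idx0 H) (fun a => w \in X a) (fun a => \dim (X a)) w0) => a wa amin.
exists a; split=> // b wb.
have [c cE] := coll_cap a b.
have wc : w \in X c by rewrite cE memv_cap wa wb.
have ca : (X c <= X a)%VS by rewrite cE capvSl.
have -> : X a = X c by apply/esym/eqP; rewrite eqEdim ca amin.
by rewrite cE capvSr.
Qed.

Lemma regular_faceP a w : regular_face (H := H) a w <->
  [/\ dot w w = 1, w \in X a & forall b, w \in X b -> (X a <= X b)%VS].
Proof.
split=> [[[ww wa] nb]|[ww wa minw]].
  split=> // b wb; apply: contrapT => /negP ab.
  by apply: nb; exists b => //=; rewrite le_idxE.
by split=> // -[b]; rewrite /= le_idxE => /negP nab [_ wb]; apply/nab/minw.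
Qed.

Lemma regular_face_uniq a b w :
  regular_face (H := H) a w -> regular_face (H := H) b w -> a = b.
Proof.
move=> /regular_faceP[_ wa ma] /regular_faceP[_ wb mb].
by apply/coll_inj/eqP; rewrite eqEsubv ma // mb.
Qed.

(** The default [idx0] is never reached on the sphere, which the regular faces partition. *)
Definition face_idx w : idx H :=
  odflt (idx0 H) [pick a | `[< regular_face a w >]].

Lemma face_idxP w : dot w w = 1 -> regular_face (face_idx w) w.
Proof.
move=> ww; rewrite /face_idx; case: pickP => [a /asboolP //|no] /=.
have [a [wa ma]] := ex_minimal_coll w.
by have /asboolP[] := no a; apply/regular_faceP.
Qed.

Lemma face_idxE a w : regular_face (H := H) a w -> face_idx w = a.
Proof.
move=> wa; have [ww _ _] := (regular_faceP a w).1 wa.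
exact: regular_face_uniq (face_idxP ww) wa.
Qed.

Lemma mem_face_idx w : dot w w = 1 -> w \in X (face_idx w).
Proof. by move=> /face_idxP/regular_faceP[]. Qed.

Lemma face_idx_min w b : dot w w = 1 ->
  (X (face_idx w) <= X b)%VS = (w \in X b).
Proof.
move=> ww; apply/idP/idP => [/subvP|]; first by apply; exact: mem_face_idx.
by have /regular_faceP[_ _] := face_idxP ww; apply.
Qed.

Lemma proj1E p : (Defs.proj H p).1 = p.1.
Proof. by rewrite /Defs.proj; case: pickP. Qed.

Lemma projE p : dot p.1 p.1 = 1 ->
  Defs.proj H p = (p.1, oproj (X (face_idx p.1)) p.2).
Proof.
move=> pp; rewrite /Defs.proj; case: pickP => [a /asboolP pa|no].
  by rewrite (face_idxE pa).
by have /asboolP[] := no (face_idx p.1); exact: face_idxP.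
Qed.

Lemma dot1_proj v p : dot v p.1 = dot v (Defs.proj H p).1.
Proof. by rewrite proj1E. Qed.

Lemma dot12_proj p : dot p.1 p.1 = 1 ->
  dot p.1 p.2 = dot (Defs.proj H p).1 (Defs.proj H p).2.
Proof. by move=> pp; rewrite projE //= dot_oproj // mem_face_idx. Qed.

(* For v in X_a the function xi |-> v.xi is pi-invariant near C'_a; multiplying
   it by this polynomial, which vanishes on the faces where it is not, makes
   it globally pi-invariant. *)
Definition cutoff a w : R := \prod_(b | ~~ (X a <= X b)%VS) sqdist (X b) w.

Lemma cutoff_neq0 a w : dot w w = 1 ->
  (cutoff a w != 0) = (X a <= X (face_idx w))%VS.
Proof.
move=> ww; rewrite prodf_seq_neq0; apply/allP/idP => [nz|aw b _].
  apply: contraT => naw; have := nz (face_idx w) (mem_index_enum _).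
  by rewrite naw /= sqdist_eq0 mem_face_idx.
apply/implyP; apply: contra; rewrite sqdist_eq0 -face_idx_min // => wb.
exact: subv_trans aw wb.
Qed.

Lemma polyfun_cutoff a : polyfun (fun p : phase => cutoff a p.1).
Proof. by apply: polyfun_prod => b _; exact: polyfun_sqdist. Qed.

Lemma polyfun_cutoff_dot a v (c : R) :
  polyfun (fun p : phase => cutoff a p.1 * (dot v p.2 + - c)).
Proof.
apply: polyfun_mul; first exact: polyfun_cutoff.
by apply: polyfun_add; [exact: polyfun_dot2|exact: polyfun_cst].
Qed.

(** Where the cutoff is nonzero the index subspace contains X_a, and projecting xi onto it leaves
    v.xi unchanged; elsewhere both sides vanish. *)
Lemma cutoff_dot_proj a v (c : R) p : v \in X a -> dot p.1 p.1 = 1 ->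
  cutoff a p.1 * (dot v p.2 - c) =
  cutoff a (Defs.proj H p).1 * (dot v (Defs.proj H p).2 - c).
Proof.
move=> va pp; rewrite projE //=.
have [|] := eqVneq (cutoff a p.1) 0; first by move=> ->; rewrite !mul0r.
by rewrite cutoff_neq0 // => /subvP/(_ v va) vp; rewrite dot_oproj.
Qed.

End RegularFaces.

(** * Derivatives and energies along a bicharacteristic *)

Section Bicharacteristics.
Variables (R : realType) (n : nat) (H : many_body R n).
Variables (E : seq R) (EP : forall e, thresholds H e -> e \in E).
Variables (l : R) (J : set R) (gamma : R -> 'rV[R]_n * 'rV[R]_n).
Hypothesis G : gen_broken_bichar H l J gamma.
Local Notation X := (@coll R n H).
Local Notation phase := ('rV[R]_n * 'rV[R]_n)%type.
Local Notation W t := (gamma t).1.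
Local Notation Xi t := (gamma t).2.
Local Notation A t := (face_idx H (W t)).
Local Notation eta t := (dot (W t) (Xi t)).
Implicit Types (a b : idx H) (v w : 'rV[R]_n) (p : phase) (f : phase -> R).

Lemma char_set_unit b p : char_set b l p -> dot p.1 p.1 = 1.
Proof. by case=> -[]. Qed.

(** As X_b contains a unit vector, b < 1, so the eigenvalue l - |xi|^2 of H^b is a threshold. *)
Lemma char_set_energy b p : char_set (H := H) b l p ->
  exists2 e, e \in E & dot p.2 p.2 = l - e.
Proof.
move=> [[pp pb] _ sp]; exists (l - dot p.2 p.2); last by rewrite opprB addrC subrK.
apply: EP; exists b => //=; rewrite /lt_idx le_idxE coll_idx1 sub0v /=.
apply: contraTneq pb => ->; rewrite coll_idx1 memv0 -dot_eq0 pp.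
exact: oner_neq0.
Qed.

Lemma bichar_char t : J t ->
  exists b p, [/\ char_set (H := H) b l p, p.1 = W t &
    Xi t = oproj (X (A t)) p.2].
Proof.
case: G => Gc _ _ /Gc[b _ [p pc pg]]; exists b, p.
have pp := char_set_unit pc.
by split=> //; rewrite -pg projE.
Qed.

Lemma bichar_unit t : J t -> dot (W t) (W t) = 1.
Proof. by move=> /bichar_char[b [p [pc <- _]]]; exact: char_set_unit pc. Qed.

Lemma bichar_mem t : J t -> Xi t \in X (A t).
Proof. by move=> /bichar_char[b [p [_ _ ->]]]; exact: oproj_mem. Qed.

Lemma bichar_energy_le t : J t -> exists2 e, e \in E & dot (Xi t) (Xi t) <= l - e.
Proof.
move=> /bichar_char[b [p [/char_set_energy[e eE pe] _ ->]]]; exists e => //.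
by rewrite -pe dot_oproj_le.
Qed.

(** By invariance under [proj], the set where [f] is close to its value at [gamma t] is open in the
    quotient topology. *)
Lemma bichar_continuous f : polyfun f ->
  (forall p, dot p.1 p.1 = 1 -> f p = f (Defs.proj H p)) ->
  {within J, continuous (f \o gamma)}.
Proof.
move=> pf fproj; apply/subspace_continuousP => t Jt.
apply/cvgrPdist_lt => e e0; case: G => _ Gcont _.
apply: (Gcont [set q | `|f (gamma t) - f q| < e] _ t Jt); last first.
  by rewrite /= subrr normr0.
exists [set q | `|f (gamma t) - f q| < e]; split; last first.
  by move=> p pp; rewrite /= -fproj.
have -> : [set q | `|f (gamma t) - f q| < e] = f @^-1` ball (f (gamma t)) e.
  by [].
apply: open_comp; last exact: ball_open.
by move=> q _; exact: polyfun_continuous.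
Qed.

(** The points of \dot T are realized inside phase space, so [f] serves as its own [fpi]; the left
    and right Dini bounds combine into one on a punctured neighbourhood. *)
Lemma bichar_quot_gt f t m : polyfun f ->
  (forall p, dot p.1 p.1 = 1 -> f p = f (Defs.proj H p)) -> J t ->
  (forall b p, char_set (H := H) b l p -> p.1 = W t ->
     oproj (X (A t)) p.2 = Xi t -> m <= 'D_(scH p) f p) ->
  forall e, 0 < e -> \forall s \near t^',
    J s -> m - e < (f (gamma s) - f (gamma t)) / (s - t).
Proof.
move=> pf fproj Jt mD; case: G => _ _ Gd.
have rt := face_idxP H (bichar_unit Jt).
have mi F : F = t^'- \/ F = t^'+ -> (m%:E <= dini J F (f \o gamma) t)%E.
  move=> FE; apply: le_trans (Gd t _ f f F Jt rt (bichar_mem Jt) _ FE).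
    apply: le_ereal_inf_tmp => _ [b [p [_ pc pg ->]]]; rewrite lee_fin.
    have pp := char_set_unit pc.
    have pW : p.1 = W t by rewrite -pg projE.
    by apply: mD pc pW _; rewrite -pg projE.
  by split; [exact: polyfun_smooth|exact: fproj].
by apply: (@dini_two_sided_gt _ J (f \o gamma)); apply: mi; [left|right].
Qed.

(** The derivative being the same at all points over [gamma t], the lower bounds for [f] and for its
    negative meet. *)
Lemma bichar_quot f t q : polyfun f ->
  (forall p, dot p.1 p.1 = 1 -> f p = f (Defs.proj H p)) -> J t ->
  (forall p, p.1 = W t -> oproj (X (A t)) p.2 = Xi t -> 'D_(scH p) f p = q) ->
  quot_within J (f \o gamma) t q.
Proof.
move=> pf fproj Jt fD e e0.
have pg : polyfun (fun p => -1 * f p).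
  by apply: polyfun_mul => //; exact: polyfun_cst.
have gproj p : dot p.1 p.1 = 1 -> -1 * f p = -1 * f (Defs.proj H p).
  by move=> pp; rewrite fproj.
have L : forall b p, char_set (H := H) b l p -> p.1 = W t ->
     oproj (X (A t)) p.2 = Xi t -> q <= 'D_(scH p) f p.
  by move=> b p _ pW pX; rewrite fD.
have U : forall b p, char_set (H := H) b l p -> p.1 = W t ->
     oproj (X (A t)) p.2 = Xi t -> - q <= 'D_(scH p) (fun p => -1 * f p) p.
  move=> b p _ pW pX.
  have df : derivable f p (scH p) by apply/diff_derivable/polyfun_differentiable.
  by rewrite (deriveZ (-1) df) fD // scaleN1r.
have := bichar_quot_gt pf fproj Jt L e0; have := bichar_quot_gt pg gproj Jt U e0.
apply: filterS2 => s Us Ls Js; have {}Us := Us Js; have {}Ls := Ls Js.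
rewrite ltr_norml /=; apply/andP; split; first by move: Ls; rewrite /=; lra.
have <- : - ((-1 * f (gamma s) - -1 * f (gamma t)) / (s - t)) =
  ((f \o gamma) s - (f \o gamma) t) / (s - t).
  by rewrite -mulNr opprB !mulN1r opprK addrC.
by move: Us; lra.
Qed.

Lemma bichar_continuous_dot1 v : {within J, continuous (fun t => dot v (W t))}.
Proof.
apply: (bichar_continuous (polyfun_dot1 v)) => p _; exact: dot1_proj.
Qed.

Lemma bichar_continuous_eta : {within J, continuous (fun t => eta t)}.
Proof.
apply: (bichar_continuous (@polyfun_dot12 R n)) => p pp; exact: dot12_proj.
Qed.

(** The derivative involves xi only through v.xi and omega.xi, and all points over [gamma t] share
    these because [v] and omega lie in the index subspace. *)
Lemma bichar_derive_dot1 v t : J t -> v \in X (A t) ->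
  quot_within J (fun s => dot v (W s)) t (2 * (dot v (Xi t) - eta t * dot v (W t))).
Proof.
move=> Jt vA; apply: (bichar_quot (polyfun_dot1 v)) => //.
  by move=> p _; exact: dot1_proj.
move=> p pW pX; rewrite derive_dot1 dotZr dotBr dotZr -pX dot_oproj // pW.
by rewrite dot_oproj // mem_face_idx // bichar_unit.
Qed.

(** The index can only drop near [t], since its cutoff is continuous along [gamma] and nonzero at
    [t]. *)
Lemma bichar_face_near t : J t ->
  \forall s \near t, J s -> (X (A t) <= X (A s))%VS.
Proof.
move=> Jt; have Wt := bichar_unit Jt.
have c0 : cutoff (A t) (W t) != 0 by rewrite cutoff_neq0.
have cont : {within J, continuous (fun s => cutoff (A t) (W s))}.
  by apply: (bichar_continuous (@polyfun_cutoff R n H (A t))) => p _; rewrite proj1E.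
have /subspace_continuousP/(_ t Jt)/cvgrPdist_lt/(_ `|cutoff (A t) (W t)|) := cont.
rewrite normr_gt0 => /(_ c0); rewrite /within /= => near_c.
have {}near_c : \forall s \near t, J s ->
  `|cutoff (A t) (W t) - cutoff (A t) (W s)| < `|cutoff (A t) (W t)| by [].
apply: filterS near_c => s cs Js; rewrite -cutoff_neq0 ?bichar_unit //.
by apply: contraTneq (cs Js) => ->; rewrite subr0 ltxx.
Qed.

(* The test function vanishes at gamma t to first order in the cutoff, so no
   derivative of the cutoff enters. *)
Lemma bichar_derive_dot2 v t : J t -> v \in X (A t) ->
  quot_within J (fun s => dot v (Xi s)) t 0.
Proof.
move=> Jt vA; have Wt := bichar_unit Jt.
set k := cutoff (A t) (W t).
have k0 : k != 0 by rewrite /k cutoff_neq0.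
have q0 : quot_within J (fun s => cutoff (A t) (W s) *
    (dot v (Xi s) - dot v (Xi t))) t 0.
  apply: (bichar_quot (polyfun_cutoff_dot (A t) v (dot v (Xi t)))) => //.
    by move=> p pp; exact: cutoff_dot_proj.
  move=> p pW pX; rewrite deriveM.
  - rewrite /= deriveD.
    + rewrite derive_dot2 dot0r derive_cst addr0 scaler0 add0r.
      by rewrite -pX dot_oproj // subrr scale0r.
    + exact/diff_derivable/polyfun_differentiable/polyfun_dot2.
    + exact: derivable_cst.
  - exact/diff_derivable/polyfun_differentiable/polyfun_cutoff.
  - apply/diff_derivable/polyfun_differentiable; apply: polyfun_add.
    + exact: polyfun_dot2.
    + exact: polyfun_cst.
(* Near [t] the cutoff keeps at least half of its size, so it can be divided out of the quotient. *)
move=> e e0; have k2 : 0 < `|k| / 2 by rewrite divr_gt0 // normr_gt0.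
have cont : {within J, continuous (fun s => cutoff (A t) (W s))}.
  by apply: (bichar_continuous (@polyfun_cutoff R n H (A t))) => p _; rewrite proj1E.
have /subspace_continuousP/(_ t Jt)/cvgrPdist_lt/(_ _ k2) := cont.
move=> near_c; have {}near_c : \forall s \near t, J s ->
  `|k - cutoff (A t) (W s)| < `|k| / 2 by [].
have := q0 _ (mulr_gt0 e0 k2).
apply: filterS2 (nbhs_dnbhs near_c) => s cs qs Js.
have {}cs := cs Js; have := qs Js; rewrite subrr mulr0 !subr0 -mulrA normrM => qe.
have ck : `|k| / 2 < `|cutoff (A t) (W s)|.
  by have := ler_normD (k - cutoff (A t) (W s)) (cutoff (A t) (W s)); rewrite subrK; lra.
rewrite -(ltr_pM2l k2) [ltRHS]mulrC; apply: le_lt_trans qe.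
by rewrite ler_wpM2r // ltW.
Qed.

(** Every characteristic point over [gamma t] has energy [l - e], at least |xi_a|^2, for one of
    finitely many [e]. Were equality excluded, the gap [g] would put the lower bound for the
    derivative of omega.xi at least [2 * g] above its assumed value. *)
Lemma bichar_energy t : J t -> (\forall s \near t, J s) ->
  is_derive t 1 (fun s => eta s) (2 * (dot (Xi t) (Xi t) - eta t ^+ 2)) ->
  exists2 e, e \in E & dot (Xi t) (Xi t) = l - e.
Proof.
move=> Jt nJ de; apply: contrapT => noE.
have [g g0 gE] : exists2 g, 0 < g & forall e, e \in E ->
    dot (Xi t) (Xi t) <= l - e -> dot (Xi t) (Xi t) + g <= l - e.
  have {noE} : forall e, e \in E -> dot (Xi t) (Xi t) != l - e.
    by move=> e eE; apply/eqP => Ee; apply: noE; exists e.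
  elim: E => [|e s IH] noE; first by exists 1.
  have [|g g0 gs] := IH; first by move=> d ds; apply: noE; rewrite in_cons ds orbT.
  have [le_e|lt_e] := leP (dot (Xi t) (Xi t)) (l - e); last first.
    exists g => // d; rewrite in_cons => /predU1P[->|]; last exact: gs.
    by rewrite leNgt lt_e.
  have lt_e : dot (Xi t) (Xi t) < l - e.
    by rewrite lt_neqAle le_e noE ?mem_head.
  exists (Num.min g (l - e - dot (Xi t) (Xi t))).
    by rewrite lt_min g0 subr_gt0.
  move=> d; rewrite in_cons => /predU1P[-> _|ds dle].
    by rewrite -lerBrDl ge_min lexx orbT.
  by apply: le_trans (gs d ds dle); rewrite lerD2l ge_min lexx.
pose m := 2 * (dot (Xi t) (Xi t) + g - eta t ^+ 2).
have mD b p : char_set (H := H) b l p -> p.1 = W t ->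
    oproj (X (A t)) p.2 = Xi t ->
    m <= 'D_(scH p) (fun p => dot p.1 p.2) p.
  move=> pc pW pX; have pp := char_set_unit pc.
  have [e eE pe] := char_set_energy pc.
  have pe' : dot p.1 p.2 = eta t.
    by rewrite -pX -pW dot_oproj // pW mem_face_idx // bichar_unit.
  rewrite derive_dot12 /= dot0r addr0 dotZl dotBl dotZl pe' -expr2 /m.
  rewrite ler_pM2l // lerD2r pe; apply: gE => //.
  by rewrite -pe -pX dot_oproj_le.
have g2 : 0 < g / 2 by rewrite divr_gt0.
have fproj p : dot p.1 p.1 = 1 -> dot p.1 p.2 =
  dot (Defs.proj H p).1 (Defs.proj H p).2 by exact: dot12_proj.
have n1 := bichar_quot_gt (@polyfun_dot12 R n) fproj Jt mD g0.
have n2 := @is_derive_quot_within _ J _ _ _ de _ g0.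
have [s [s1 s2 Js]] : exists s, [/\ J s -> m - g < (eta s - eta t) / (s - t),
    J s -> `|(eta s - eta t) / (s - t) - 2 * (dot (Xi t) (Xi t) - eta t ^+ 2)| < g
    & J s].
  apply: (@filter_ex _ (t^')); apply: filterS3 n1 n2 (nbhs_dnbhs nJ) => s; by split.
have := s1 Js; have := s2 Js; rewrite ltr_norml /m => /andP[_]; lra.
Qed.

End Bicharacteristics.

(** * Arc length of the direction *)

Section ArcLength.
Variable R : realType.
Implicit Types (x y z k : R).

Definition clamp1 x : R := Num.max (-1) (Num.min 1 x).

Lemma clamp1_id x : `|x| <= 1 -> clamp1 x = x.
Proof. by rewrite ler_norml /clamp1 => /andP[x1 x2]; rewrite min_r // max_r. Qed.

Lemma clamp1_le x y : x <= y -> clamp1 x <= clamp1 y.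
Proof.
move=> xy; rewrite /clamp1 ge_max le_max lexx /= le_max.
by apply/orP; right; rewrite le_min ge_min lexx /= ge_min xy orbT.
Qed.

Lemma clamp1_bounds x : -1 <= clamp1 x <= 1.
Proof.
rewrite /clamp1 le_max lexx /= ge_max ge_min lexx /= andbT.
lra.
Qed.

(* An algebraic stand-in for arcsin: bounded and nondecreasing, with derivative at
   least 1 / (2 sqrt (1 - x ^ 2)) on ]-1, 1[. *)
Definition arc x : R := Num.sqrt (1 + clamp1 x) - Num.sqrt (1 - clamp1 x).

Lemma arc_le x y : x <= y -> arc x <= arc y.
Proof.
move=> /clamp1_le xy; rewrite /arc lerB //; apply: ler_wsqrtr.
- by rewrite lerD2l.
- by rewrite lerD2l lerN2.
Qed.

Lemma arc_bound x : `|arc x| <= 2.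
Proof.
have /andP[c1 c2] := clamp1_bounds x.
have s4 : Num.sqrt 4 = 2 :> R.
  by rewrite (_ : 4 = 2 ^+ 2); [rewrite sqrtr_sqr ger0_norm|rewrite -natrX].
have h1 : Num.sqrt (1 + clamp1 x) <= 2 by rewrite -s4 ler_wsqrtr //; lra.
have h2 : Num.sqrt (1 - clamp1 x) <= 2 by rewrite -s4 ler_wsqrtr //; lra.
have p1 := sqrtr_ge0 (1 + clamp1 x); have p2 := sqrtr_ge0 (1 - clamp1 x).
by rewrite ler_norml /arc; apply/andP; split; lra.
Qed.

Lemma within_arc (f : R -> R) (J : set R) : {within J, continuous f} ->
  {within J, continuous (fun x => arc (f x))}.
Proof.
move=> cf; have c1 : continuous clamp1.
  move=> x; have cx : {for x, continuous (id : R -> R^o)} by [].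
  have k1 : {for x, continuous (cst 1 : R -> R^o)} by exact: cst_continuous.
  have kN1 : {for x, continuous (cst (-1) : R -> R^o)} by exact: cst_continuous.
  exact: continuous_max kN1 (continuous_min k1 cx).
have cc : {within J, continuous (fun x => clamp1 (f x))}.
  move=> x; apply: (@continuous_comp _ _ _ (f : subspace J -> R) clamp1 x (cf x)).
  exact: c1.
apply: withinB; apply: within_sqrt.
- by apply: withinD => //; exact: within_cst.
- by apply: withinB => //; exact: within_cst.
Qed.

Lemma is_derive_arc (f : R -> R) (t d : R) : (\forall s \near t, `|f s| < 1) ->
  is_derive t 1 f d ->
  is_derive t 1 (fun s => arc (f s))
    (d / (2 * Num.sqrt (1 + f t)) + d / (2 * Num.sqrt (1 - f t))).
Proof.
move=> nf fd; have := nbhs_singleton nf; rewrite ltr_norml => /andP[f1 f2].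
have dP : is_derive t 1 (fun s => 1 + f s) d.
  by rewrite -[d]add0r; exact: is_derive_addf (is_derive_constf 1 t) fd.
have dM : is_derive t 1 (fun s => 1 - f s) (- d).
  by rewrite -[- d]add0r; exact: is_derive_subf (is_derive_constf 1 t) fd.
have sP : 0 < 1 + f t by lra.
have sM : 0 < 1 - f t by lra.
have D := is_derive_subf (@is_derive_sqrtf _ (fun s => 1 + f s) t _ sP dP)
  (@is_derive_sqrtf _ (fun s => 1 - f s) t _ sM dM).
rewrite mulNr opprK in D; apply: near_eq_is_derive D.
by apply: filterS nf => s fs; rewrite /arc clamp1_id // ltW.
Qed.

(* For x = zeta / k, k ^ 2 = kappa and r = |y| this reads |theta'| <= 2 (arc (zeta / k))'. *)
Lemma arc_speed x k r s : `|x| < 1 -> 0 < k -> 0 < r ->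
  s ^+ 2 <= k ^+ 2 * (1 - x ^+ 2) ->
  2 * s / r <= 2 * ((2 * (k ^+ 2 * (1 - x ^+ 2)) / r / k) / (2 * Num.sqrt (1 + x)) +
     (2 * (k ^+ 2 * (1 - x ^+ 2)) / r / k) / (2 * Num.sqrt (1 - x))).
Proof.
rewrite ltr_norml => /andP[x1 x2] k0 r0 sk.
have P0 : 0 < Num.sqrt (1 + x) by rewrite sqrtr_gt0; lra.
have M0 : 0 < Num.sqrt (1 - x) by rewrite sqrtr_gt0; lra.
have P2 : Num.sqrt (1 + x) ^+ 2 = 1 + x by rewrite sqr_sqrtr //; lra.
have M2 : Num.sqrt (1 - x) ^+ 2 = 1 - x by rewrite sqr_sqrtr //; lra.
set P := Num.sqrt (1 + x) in P0 P2 *; set M := Num.sqrt (1 - x) in M0 M2 *.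
have E : 1 - x ^+ 2 = P ^+ 2 * M ^+ 2 by rewrite P2 M2; ring.
rewrite E.
have -> : 2 * (2 * (k ^+ 2 * (P ^+ 2 * M ^+ 2)) / r / k / (2 * P) +
   2 * (k ^+ 2 * (P ^+ 2 * M ^+ 2)) / r / k / (2 * M)) =
   2 * (k * P * M * (P + M)) / r by field; rewrite !gt_eqF.
rewrite ler_pM2r ?invr_gt0 // ler_pM2l //.
have kPM : 0 < k * P * M by rewrite !mulr_gt0.
(* Here [P ^+ 2 + M ^+ 2 = 2] and [P * M] is positive. *)
have PM1 : 1 <= P + M.
  rewrite -(@ler_pXn2r _ 2) ?nnegrE ?addr_ge0 ?ltW // expr1n sqrrD P2 M2.
  have : 0 < P * M by rewrite mulr_gt0.
  lra.
apply: (@le_trans _ _ (k * P * M)); last by rewrite ler_peMr // ltW.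
apply: le_trans (ler_norm s) _.
rewrite -(@ler_pXn2r _ 2) ?nnegrE ?normr_ge0 ?(ltW kPM) // real_normK ?num_real //.
by apply: le_trans sk _; rewrite E !exprMn mulrA.
Qed.

End ArcLength.

(** * Polar coordinates about the axis X_a *)

Section Cone.
Variables (R : realType) (n : nat) (H : many_body R n).
Variables (E : seq R) (EP : forall e, thresholds H e -> e \in E).
Variables (l : R) (J : set R) (gamma : R -> 'rV[R]_n * 'rV[R]_n).
Hypothesis G : gen_broken_bichar H l J gamma.
Hypothesis iJ : is_interval J.
Local Notation X := (@coll R n H).
Local Notation W t := (gamma t).1.
Local Notation Xi t := (gamma t).2.
Local Notation A t := (face_idx H (W t)).
Local Notation eta t := (dot (W t) (Xi t)).
Implicit Types (a b c : idx H) (v : 'rV[R]_n) (s t u : R).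

Lemma bichar_interior s t u : J t -> J u -> t < s < u ->
  J s /\ \forall r \near s, J r.
Proof.
move=> Jt Ju tsu; have nJ := interval_near iJ Jt Ju tsu.
by split=> //; exact: nbhs_singleton nJ.
Qed.

Lemma bichar_within_dot2 a v t u : J t -> J u -> v \in X a ->
  (forall s, t <= s <= u -> (X a <= X (A s))%VS) ->
  {within `[t, u], continuous (fun s => dot v (Xi s))}.
Proof.
move=> Jt Ju va aA; apply/subspace_continuousP => s; rewrite /= in_itv /= => stu.
have Js : J s by exact: iJ Jt Ju _ stu.
have sub : `[t, u]%classic `<=` J by exact: segment_sub.
have := quot_within_cvg (bichar_derive_dot2 G Js (subvP (aA s stu) v va)).
by apply: cvg_trans; apply: cvg_app; exact: within_subset.
Qed.

Lemma bichar_dot2_const a v t u : J t -> J u -> t <= u -> v \in X a ->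
  (forall s, t <= s <= u -> (X a <= X (A s))%VS) ->
  dot v (Xi t) = dot v (Xi u).
Proof.
move=> Jt Ju tu va aA.
apply: (@derive0_eq R (fun s => dot v (Xi s)) (fun=> 0)) => //.
  exact: (bichar_within_dot2 Jt Ju va aA).
move=> s tsu; have [Js nJ] := bichar_interior Jt Ju tsu.
apply: quot_within_derive nJ _; apply: (bichar_derive_dot2 G Js).
by apply: (subvP (aA s _)) => //; case/andP: tsu => *; rewrite !ltW.
Qed.

Lemma bichar_oproj_const a t u : J t -> J u -> t <= u ->
  (forall s, t <= s <= u -> (X a <= X (A s))%VS) ->
  oproj (X a) (Xi t) = oproj (X a) (Xi u).
Proof.
move=> Jt Ju tu aA; apply: dot_inj => v; rewrite -!dot_oprojC.
exact: (bichar_dot2_const Jt Ju tu (oproj_mem _ v) aA).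
Qed.

(** While the index is constant, omega stays in the index subspace, and an arbitrary [v] may be
    replaced by its projection there. *)
Lemma bichar_derive_dot1_near v s : J s -> (\forall r \near s, J r) ->
  (\forall r \near s, A r = A s) ->
  is_derive s 1 (fun r => dot v (W r)) (2 * (dot v (Xi s) - eta s * dot v (W s))).
Proof.
move=> Js nJ nA; have Xs := bichar_mem G Js; have Ws := mem_face_idx H (bichar_unit G Js).
have D := quot_within_derive nJ (bichar_derive_dot1 G Js (oproj_mem (X (A s)) v)).
rewrite 2!dot_oprojC (oproj_id Xs) (oproj_id Ws) in D.
apply: near_eq_is_derive D; apply: filterS2 nA nJ => r Ar Jr.
by rewrite dot_oprojC oproj_id // -Ar mem_face_idx // (bichar_unit G).
Qed.

Variables (a : idx H) (x0 : 'rV[R]_n).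

(* With omega = pi_a omega + y, these are |y| ^ 2, |y|, y.xi, zeta = y.xi / |y| and
   v.theta = v.y / |y|; x0 is the conserved xi_a. Only the components of omega along
   X_a enter |y| ^ 2, because their derivatives are known at every time. *)
Definition rad2 t : R := 1 - \sum_i dot (oproj (X a) (delta_mx 0 i)) (W t) ^+ 2.
Definition rad t : R := Num.sqrt (rad2 t).
Definition radmom t : R := eta t - dot x0 (W t).
Definition radvel t : R := radmom t / rad t.
Definition dirdot v t : R := dot (v - oproj (X a) v) (W t) / rad t.

Lemma rad2E t : J t -> rad2 t = sqdist (X a) (W t).
Proof.
move=> Jt; rewrite /rad2 /sqdist dot_sub_oproj (bichar_unit G Jt); congr (_ - _).
rewrite dotE; apply: eq_bigr => i _.
by rewrite dot_oprojC dot_delta expr2.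
Qed.

Lemma within_rad2 : {within J, continuous rad2}.
Proof.
apply: withinB; first exact: within_cst.
apply: within_sum => i; under eq_fun do rewrite expr2.
by apply: withinM; exact: (bichar_continuous_dot1 G).
Qed.

Lemma within_radmom : {within J, continuous radmom}.
Proof.
apply: withinB; first exact: (bichar_continuous_eta G).
exact: (bichar_continuous_dot1 G).
Qed.

(** Only X_a-components of omega are differentiated, so the equation holds at breaks too; the
    Gronwall argument at the axis relies on that. *)
Lemma is_derive_rad2 t : J t -> (\forall s \near t, J s) ->
  (X a <= X (A t))%VS -> oproj (X a) (Xi t) = x0 ->
  is_derive t 1 rad2 (4 * (radmom t - eta t * rad2 t)).
Proof.
move=> Jt nJ aA x0E.
pose p i := oproj (X a) (delta_mx 0 i).
have pd i : is_derive t 1 (fun s => dot (p i) (W s))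
    (2 * (dot (p i) (Xi t) - eta t * dot (p i) (W t))).
  apply: quot_within_derive nJ _; apply: (bichar_derive_dot1 G Jt).
  by apply: (subvP aA); exact: oproj_mem.
have pd2 i := is_derive_mulf (pd i) (pd i).
have := is_derive_subf (is_derive_constf 1 t) (is_derive_sumf pd2).
have -> : (fun s => 1 - \sum_i dot (p i) (W s) * dot (p i) (W s)) = rad2.
  by apply/funext => s; congr (_ - _); apply: eq_bigr => i _; rewrite expr2.
move=> D; apply: is_derive_eq D _; rewrite sub0r.
have -> : \sum_(i < n) (2 * (dot (p i) (Xi t) - eta t * dot (p i) (W t)) * dot (p i) (W t) +
     dot (p i) (W t) * (2 * (dot (p i) (Xi t) - eta t * dot (p i) (W t)))) =
   4 * (\sum_i dot (p i) (W t) * dot (p i) (Xi t)) -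
   4 * eta t * \sum_i dot (p i) (W t) ^+ 2.
  by rewrite !mulr_sumr -sumrB; apply: eq_bigr => i _; ring.
have -> : \sum_i dot (p i) (W t) * dot (p i) (Xi t) = dot x0 (W t).
  transitivity (dot (oproj (X a) (W t)) (oproj (X a) (Xi t))).
    by rewrite dotE; apply: eq_bigr => i _; rewrite /p !dot_oprojC !dot_delta.
  by rewrite dot_oprojC oproj_id ?oproj_mem // x0E dotC.
by rewrite /radmom /rad2 -/p; ring.
Qed.

End Cone.

(** * Monotonicity on an interval of constant index *)

Section Piece.
Variables (R : realType) (n : nat) (H : many_body R n).
Variables (E : seq R) (EP : forall e, thresholds H e -> e \in E).
Variables (l : R) (J : set R) (gamma : R -> 'rV[R]_n * 'rV[R]_n).
Hypothesis G : gen_broken_bichar H l J gamma.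
Hypothesis iJ : is_interval J.
Local Notation X := (@coll R n H).
Local Notation W t := (gamma t).1.
Local Notation Xi t := (gamma t).2.
Local Notation A t := (face_idx H (W t)).
Local Notation eta t := (dot (W t) (Xi t)).
Variables (a : idx H) (x0 : 'rV[R]_n).
Local Notation rad2 := (rad2 gamma a).
Local Notation rad := (rad gamma a).
Local Notation radmom := (radmom gamma x0).
Local Notation radvel := (radvel gamma a x0).
Local Notation dirdot := (dirdot gamma a).

(* The terms with l - e <= |x0| ^ 2 vanish, as sqrt is 0 there and x / 0 = 0. *)
Definition arcsum (r : R) : R :=
  \sum_(e <- E) 2 * arc (radvel r / Num.sqrt (l - e - dot x0 x0)).

Lemma arcsum_bound r : `|arcsum r| <= 4 * (size E)%:R.
Proof.
rewrite /arcsum; elim: E => [|e s IH]; first by rewrite big_nil normr0 mulr0.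
rewrite big_cons /= -[(size s).+1]add1n natrD [leRHS]mulrDr mulr1.
apply: le_trans (ler_normD _ _) _.
apply: lerD => //; rewrite normrM ger0_norm //.
by have := arc_bound (radvel r / Num.sqrt (l - e - dot x0 x0)); lra.
Qed.

(** All summands are nondecreasing in the radial velocity, so the sum grows at least as much as the
    summand of the current energy. *)
Lemma arcsum_increment r s e : e \in E -> radvel r <= radvel s ->
  2 * arc (radvel s / Num.sqrt (l - e - dot x0 x0)) -
  2 * arc (radvel r / Num.sqrt (l - e - dot x0 x0)) <= arcsum s - arcsum r.
Proof.
move=> eE rs; rewrite /arcsum -sumrB (big_rem e) //= lerDl.
apply: sumr_ge0 => d _; rewrite subr_ge0 ler_pM2l //; apply: arc_le.
by rewrite ler_wpM2r // invr_ge0 sqrtr_ge0.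
Qed.

Lemma arcsum_mono r s : radvel r <= radvel s -> arcsum r <= arcsum s.
Proof.
move=> rs; apply: ler_sum => d _; rewrite ler_pM2l //; apply: arc_le.
by rewrite ler_wpM2r // invr_ge0 sqrtr_ge0.
Qed.

(** By Cauchy-Schwarz (omega.xi)^2 is at most |xi|^2, hence at most one of the numbers [l - e]. The
    summand 1 in [C] avoids a square root: x^2 <= S implies |x| <= 1 + S. *)
Lemma eta_bound : exists2 C, 0 <= C & forall s, J s -> `|eta s| <= C.
Proof.
pose C := 1 + \sum_(e <- E) `|l - e|; exists C.
  by rewrite addr_ge0 // sumr_ge0.
move=> s Js; have [e eE Xe] := bichar_energy_le EP G Js.
have := dot_CauchySchwarz (W s) (Xi s); rewrite (bichar_unit G Js) mul1r => h.
have Ce : `|l - e| <= \sum_(e <- E) `|l - e|.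
  by rewrite (big_rem e) //= lerDl sumr_ge0.
have := ler_norm (l - e); rewrite ler_norml /C.
by move=> le; apply/andP; split; nra.
Qed.

Variables (t u : R) (c : idx H).
Hypotheses (Jt : J t) (Ju : J u) (tu : t < u).
(** The index is fixed on the open interval only: both ends may be breaks and are reached by
    continuity. *)
Hypothesis Ac : forall s, t < s < u -> A s = c.
Hypothesis ac : (X a <= X c)%VS.
Hypothesis x0E : forall s, t <= s <= u -> oproj (X a) (Xi s) = x0.
Hypothesis r0 : forall s, t <= s <= u -> 0 < rad2 s.

Let J_in s : t <= s <= u -> J s. Proof. exact: iJ Jt Ju s. Qed.

Let lt_in s : t < s < u -> t <= s <= u.
Proof. by case/andP=> *; rewrite !ltW. Qed.

Let near_in s : t < s < u -> \forall r \near s, t < r < u.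
Proof.
move=> stu; have : \forall r \near s, r \in `]t, u[ by apply: near_in_itvoo; rewrite in_itv.
by apply: filterS => r; rewrite in_itv.
Qed.

Let xi := Xi ((t + u) / 2).

Let mid_in : t < (t + u) / 2 < u.
Proof. by rewrite !midf_lt. Qed.

Let Xi_in s : t < s < u -> Xi s \in X c.
Proof. by move=> stu; rewrite -(Ac stu); apply: (bichar_mem G); exact/J_in/lt_in. Qed.

Let xiE s : t < s < u -> Xi s = xi.
Proof.
move=> stu; rewrite -[LHS](oproj_id (Xi_in stu)) -[RHS](oproj_id (Xi_in mid_in)).
wlog : s stu / s <= (t + u) / 2 => [wl|sm].
  have [|/ltW ms] := leP s ((t + u) / 2); first exact: wl.
  apply/esym; apply: (bichar_oproj_const G iJ) => //; [exact/J_in/lt_in..|].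
  move=> r /andP[mr rs]; rewrite Ac //.
  by move: stu mid_in => /andP[_ su] /andP[tm _]; rewrite (lt_le_trans tm) // (le_lt_trans rs).
apply: (bichar_oproj_const G iJ) => //; [exact/J_in/lt_in..|].
move=> r /andP[sr rm]; rewrite Ac //.
by move: stu mid_in => /andP[ts _] /andP[_ mu]; rewrite (lt_le_trans ts) // (le_lt_trans rm).
Qed.

Let x0a : x0 \in X a.
Proof. by rewrite -(x0E (lt_in mid_in)) oproj_mem. Qed.

Let pi_xi : oproj (X a) xi = x0. Proof. exact: x0E (lt_in mid_in). Qed.

Let dot_x0_xi : dot x0 xi = dot x0 x0.
Proof. by rewrite -{3}pi_xi dot_oproj. Qed.

Let kap := dot xi xi - dot x0 x0.

Let derive_dotW v s : t < s < u ->
  is_derive s 1 (fun r => dot v (W r)) (2 * (dot v xi - eta s * dot v (W s))).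
Proof.
move=> stu; rewrite -(xiE stu).
apply: (bichar_derive_dot1_near G); first exact/J_in/lt_in.
  exact: (interval_near iJ Jt Ju stu).
by apply: filterS (near_in stu) => r rtu; rewrite !Ac.
Qed.

Let eta_in s : t < s < u -> eta s = dot xi (W s).
Proof. by move=> stu; rewrite xiE // dotC. Qed.

Let radmom_in s : t < s < u -> radmom s = dot (xi - x0) (W s).
Proof. by move=> stu; rewrite /radmom eta_in // dotBl. Qed.

Let derive_radmom s : t < s < u ->
  is_derive s 1 radmom (2 * (kap - eta s * radmom s)).
Proof.
move=> stu; have D := derive_dotW (xi - x0) stu.
rewrite -radmom_in // {1}dotBl dot_x0_xi in D; apply: near_eq_is_derive D.
by apply: filterS (near_in stu) => r rtu; rewrite radmom_in.
Qed.

Let derive_rad2 s : t < s < u ->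
  is_derive s 1 rad2 (4 * (radmom s - eta s * rad2 s)).
Proof.
move=> stu; have sI := lt_in stu.
apply: (is_derive_rad2 G (J_in sI) (interval_near iJ Jt Ju stu)); last exact: x0E.
by rewrite Ac.
Qed.

Let rad_gt0 s : t <= s <= u -> 0 < rad s.
Proof. by move=> stu; rewrite sqrtr_gt0 r0. Qed.

Let rad_sq s : t <= s <= u -> rad s ^+ 2 = rad2 s.
Proof. by move=> stu; rewrite sqr_sqrtr // ltW // r0. Qed.

(** Dividing by |y| cancels the term with omega.xi, which comes from keeping omega on the sphere.
    Both zeta and v.theta are quotients of this form. *)
Let derive_quot p al s : t < s < u ->
  is_derive s 1 p (2 * (al - eta s * p s)) ->
  is_derive s 1 (fun r => p r / rad r) (2 * (al - radvel s * (p s / rad s)) / rad s).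
Proof.
move=> stu dp; have sI := lt_in stu; have rs := rad_gt0 sI.
have dr : is_derive s 1 rad (4 * (radmom s - eta s * rad2 s) / (2 * rad s)).
  exact: (@is_derive_sqrtf _ rad2 s _ (r0 sI) (derive_rad2 stu)).
have rn0 : rad s != 0 by rewrite gt_eqF.
apply: is_derive_eq (is_derive_divf rn0 dp dr) _.
by rewrite /radvel -rad_sq //; field.
Qed.

Let derive_radvel s : t < s < u ->
  is_derive s 1 radvel (2 * (kap - radvel s ^+ 2) / rad s).
Proof.
by move=> stu; have := derive_quot stu (derive_radmom stu); rewrite -expr2.
Qed.

Let derive_dirdot v s : t < s < u ->
  is_derive s 1 (dirdot v) (2 * (dot v (xi - x0) - radvel s * dirdot v s) / rad s).
Proof.
move=> stu; have D := derive_dotW (v - oproj (X a) v) stu.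
rewrite {1}dotBl dot_oprojC pi_xi -dotBr in D.
exact: derive_quot stu D.
Qed.

(** Cauchy-Schwarz for the unit vector [v] and xi^a - zeta theta, whose squared length is kappa -
    zeta^2. *)
Let dirdot_speed v s : t < s < u -> dot v v = 1 ->
  (dot v (xi - x0) - radvel s * dirdot v s) ^+ 2 <= kap - radvel s ^+ 2.
Proof.
move=> stu vv; have sI := lt_in stu; have rn0 : rad s != 0 by rewrite gt_eqF ?rad_gt0.
pose y := W s - oproj (X a) (W s).
have yy : dot y y = rad s ^+ 2 by rewrite rad_sq // (rad2E G a (J_in sI)).
have vy : dot v y = dirdot v s * rad s.
  by rewrite /dirdot divfK // /y dotBr -dot_oprojC dotBl.
have xy : dot (xi - x0) y = radvel s * rad s.
  rewrite /radvel divfK // radmom_in // /y dotBr -dot_oprojC linearB /= pi_xi.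
  by rewrite (oproj_id x0a) subrr dot0l subr0.
have xx : dot (xi - x0) (xi - x0) = kap.
  by rewrite dotBl !dotBr (dotC xi x0) dot_x0_xi subrr subr0.
have := dot_CauchySchwarz v ((xi - x0) - (radvel s / rad s) *: y).
rewrite vv mul1r [dot v (_ - _ *: _)]dotBr dotZr vy.
rewrite [dot (_ - _ *: _) _]dotBl !(dotBr _ _ (_ *: _)) !dotZl !dotZr.
rewrite (dotC y (xi - x0)) xx xy yy.
set al := dot v _; set z := radvel s; set th := dirdot v s; set r := rad s in rn0 *.
have -> : al - z / r * (th * r) = al - z * th by field.
by have -> : kap - z / r * (z * r) - (z / r * (z * r) - z / r * (z / r * r ^+ 2)) =
  kap - z ^+ 2 by field.
Qed.

Let excess_ge0 s : t < s < u -> 0 <= kap - radvel s ^+ 2.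
Proof.
move=> stu; apply: le_trans (dirdot_speed stu (bichar_unit G (J_in (lt_in stu)))).
exact: sqr_ge0.
Qed.

(** The index is constant around the midpoint, so omega.xi is differentiable there and
    [bichar_energy] applies. *)
Let energy : exists2 e, e \in E & kap = l - e - dot x0 x0.
Proof.
have mI := J_in (lt_in mid_in); have nJ := interval_near iJ Jt Ju mid_in.
have [|e eE xe] := bichar_energy EP G mI nJ; last first.
  by exists e => //; rewrite /kap -xe.
have := derive_dotW xi mid_in; rewrite -(eta_in mid_in) -expr2 => D.
apply: near_eq_is_derive D; apply: filterS (near_in mid_in) => r rtu.
by rewrite eta_in.
Qed.

Let sub_J : `[t, u]%classic `<=` J. Proof. exact: segment_sub. Qed.

Let within_rad : {within `[t, u], continuous rad}.
Proof.
by apply: within_sqrt; apply: (continuous_subspaceW sub_J); exact: within_rad2 G a.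
Qed.

Let rad_neq0 s : `[t, u]%classic s -> rad s != 0.
Proof. by rewrite /= in_itv /= => stu; rewrite gt_eqF ?rad_gt0. Qed.

Let within_radvel : {within `[t, u], continuous radvel}.
Proof.
apply: within_div => //; apply: (continuous_subspaceW sub_J).
exact: within_radmom G x0.
Qed.

Let within_dirdot v : {within `[t, u], continuous (dirdot v)}.
Proof.
apply: within_div => //; apply: (continuous_subspaceW sub_J).
exact: bichar_continuous_dot1 G _.
Qed.

Let sub_in p q s : t < p -> p < s < q -> q < u -> t < s < u.
Proof. by move=> tp /andP[ps sq] qu; rewrite (lt_trans tp) // (lt_trans sq). Qed.

(* |y|^2 (kap - radvel^2) is the squared angular momentum; it satisfies a linear
   equation, so it vanishes identically once it vanishes. *)
Let excess_eq0 s0 s : t < s0 < u -> t < s < u -> kap - radvel s0 ^+ 2 = 0 ->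
  kap - radvel s ^+ 2 = 0.
Proof.
move=> s0tu stu q0; pose g r := rad2 r * kap - radmom r * radmom r.
have gE r : t < r < u -> g r = rad2 r * (kap - radvel r ^+ 2).
  move=> /lt_in rtu; rewrite /g /radvel -(rad_sq rtu); field.
  by rewrite gt_eqF // rad_gt0.
have [C C0 etaC] := eta_bound.
have dg r : t < r < u -> is_derive r 1 g (- (4 * eta r) * g r).
  move=> rtu; have D1 := is_derive_mulf (derive_rad2 rtu) (is_derive_constf kap r).
  have D2 := is_derive_mulf (derive_radmom rtu) (derive_radmom rtu).
  by apply: is_derive_eq (is_derive_subf D1 D2) _; rewrite /g; ring.
have g0 r : t < r < u -> 0 <= g r.
  by move=> rtu; rewrite gE // mulr_ge0 ?excess_ge0 // ltW // r0 // lt_in.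
have cg : {within J, continuous g}.
  apply: withinB; apply: withinM => //.
  - exact: within_rad2 G a.
  - exact: within_cst.
  - exact: within_radmom G x0.
  - exact: within_radmom G x0.
have cgpq p q : t < p -> q < u -> p <= q -> {within `[p, q], continuous g}.
  move=> tp qu pq; apply: continuous_subspaceW cg => r; rewrite /= in_itv /= => /andP[pr rq].
  by apply: J_in; rewrite !ltW // ?(lt_le_trans tp) // (le_lt_trans rq).
have gs0 : g s0 <= 0 by rewrite gE // q0 mulr0.
have dgC r : t < r < u -> `|- (4 * eta r) * g r| <= 4 * C * g r.
  move=> rtu; rewrite normrM (ger0_norm (g0 r rtu)) ler_wpM2r ?g0 //.
  by rewrite normrN normrM ger0_norm // ler_pM2l //; exact/etaC/J_in/lt_in.
suff : g s <= 0.
  rewrite gE // pmulr_rle0 ?r0 ?lt_in // => q1.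
  by apply/eqP; rewrite eq_le q1 excess_ge0.
move: (s0tu) (stu) => /andP[ts0 s0u] /andP[ts su].
have [ss0|/ltW s0s] := leP s s0.
- apply: (@gronwall_back_le0 R g (fun r => - (4 * eta r) * g r) (4 * C) s s0) => //.
  + exact: cgpq.
  + by move=> r rs; exact/dg/(sub_in ts rs s0u).
  + move=> r rs; have := dgC r (sub_in ts rs s0u).
    by rewrite ler_norml => /andP[].
- apply: (@gronwall_le0 R g (fun r => - (4 * eta r) * g r) (4 * C) s0 s) => //.
  + exact: cgpq.
  + by move=> r rs; exact/dg/(sub_in ts0 rs su).
  + move=> r rs; have := dgC r (sub_in ts0 rs su).
    by rewrite ler_norml => /andP[].
Qed.

Lemma radvel_piece_le : radvel t <= radvel u.
Proof.
apply: (derive_ge0_le (ltW tu) within_radvel) => s stu.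
  exact: derive_radvel.
by rewrite divr_ge0 ?mulr_ge0 ?excess_ge0 // ltW // rad_gt0 // lt_in.
Qed.

(** The derivative of the arc length function is available for |zeta| < sqrt kappa. If equality
    holds at one interior time, it holds at all of them and theta stands still; otherwise
    [arc_speed] compares the derivatives. *)
Lemma dirdot_piece_le v : dot v v = 1 ->
  dirdot v u - dirdot v t <= arcsum u - arcsum t.
Proof.
move=> vv; have [[s0 [s0tu q0]]|nq] :=
  pselect (exists s0, t < s0 < u /\ kap - radvel s0 ^+ 2 = 0).
  have -> : dirdot v u = dirdot v t.
    apply/esym; apply: (@derive0_eq R (dirdot v) (fun s =>
      2 * (dot v (xi - x0) - radvel s * dirdot v s) / rad s) t u (ltW tu)) => // s stu.
      exact: derive_dirdot.
    have := dirdot_speed stu vv; rewrite (excess_eq0 s0tu stu q0) => h.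
    have /eqP : (dot v (xi - x0) - radvel s * dirdot v s) ^+ 2 = 0.
      by apply/eqP; rewrite eq_le h sqr_ge0.
    by rewrite sqrf_eq0 => /eqP->; rewrite mulr0 mul0r.
  by rewrite subrr subr_ge0 arcsum_mono // radvel_piece_le.
have q_gt0 s : t < s < u -> 0 < kap - radvel s ^+ 2.
  move=> stu; rewrite lt_neqAle excess_ge0 // andbT eq_sym.
  by apply/eqP => q0; apply: nq; exists s.
have [e eE kapE] := energy.
have kap0 : 0 < kap.
  by have := q_gt0 _ mid_in; have := sqr_ge0 (radvel ((t + u) / 2)); lra.
set k := Num.sqrt kap; have k0 : 0 < k by rewrite sqrtr_gt0.
have k2 : k ^+ 2 = kap by rewrite sqr_sqrtr // ltW.
have z1 s : t < s < u -> `|radvel s / k| < 1.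
  move=> stu; rewrite normrM normfV (gtr0_norm k0) ltr_pdivrMr // mul1r.
  rewrite -(ltr_pXn2r (n := 2)) ?nnegrE ?normr_ge0 ?(ltW k0) //.
  by rewrite real_normK ?num_real // k2 -subr_gt0 q_gt0.
(* As [kap] equals [l - e - dot x0 x0], this is the summand of [arcsum] that belongs to [e]. *)
suff : 2 * arc (radvel t / k) - dirdot v t <= 2 * arc (radvel u / k) - dirdot v u.
  have := arcsum_increment eE radvel_piece_le; rewrite -kapE -/k; lra.
pose d s := 2 * (kap - radvel s ^+ 2) / rad s / k.
pose dth s := 2 * (dot v (xi - x0) - radvel s * dirdot v s) / rad s.
apply: (@derive_ge0_le R (fun s => 2 * arc (radvel s / k) - dirdot v s)
  (fun s => 2 * (d s / (2 * Num.sqrt (1 + radvel s / k)) +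
                 d s / (2 * Num.sqrt (1 - radvel s / k))) - dth s)).
- exact: ltW.
- apply: withinB => //; apply: withinM; first exact: within_cst.
  apply: within_arc; apply: withinM => //; exact: within_cst.
- move=> s stu.
  have dz : is_derive s 1 (fun r => radvel r / k) (d s).
    have := is_derive_mulf (derive_radvel stu) (is_derive_constf k^-1 s).
    by move=> D; apply: is_derive_eq D _; rewrite mulr0 addr0.
  have nz : \forall r \near s, `|radvel r / k| < 1.
    by apply: filterS (near_in stu) => r; exact: z1.
  exact: is_derive_subf (is_derive_scalef 2 (is_derive_arc nz dz)) (derive_dirdot v stu).
- move=> s stu; rewrite subr_ge0 /dth /d.
  have E1 : kap - radvel s ^+ 2 = k ^+ 2 * (1 - (radvel s / k) ^+ 2).
    by rewrite -k2; field; rewrite gt_eqF.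
  rewrite E1; apply: arc_speed => //; [exact: z1|exact/rad_gt0/lt_in|].
  by rewrite -E1; exact: dirdot_speed.
Qed.

End Piece.

(** * A Lebesgue number for the directions *)

Lemma finite_lower_bound (R : realType) (I : finType) (m : I -> R) :
  (forall i, 0 < m i) -> exists2 d, 0 < d & forall i, d <= m i.
Proof.
move=> m0; suff [d d0 dm] : exists2 d, 0 < d & forall i, i \in enum I -> d <= m i.
  by exists d => // i; apply: dm; rewrite mem_enum.
elim: (enum I) => [|i s [d d0 ds]]; first by exists 1.
exists (Num.min (m i) d); first by rewrite lt_min m0.
move=> j; rewrite in_cons => /predU1P[->|/ds dj]; first by rewrite ge_min lexx.
by rewrite ge_min dj orbT.
Qed.

Section LebesgueNumber.
Variables (R : realType) (n : nat) (H : many_body R n).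
Local Notation X := (@coll R n H).
Implicit Types (a b c : idx H) (w x : 'rV[R]_n) (S : {set idx H}).

Let continuous_diag : continuous (fun x : 'rV[R]_n => (x, x)).
Proof.
move=> x; apply: differentiable_continuous.
by apply: (@differentiable_pair _ _ _ _ id id).
Qed.

Lemma continuous_dot_self : continuous (fun x : 'rV[R]_n => dot x x).
Proof.
move=> x; apply: (@continuous_comp _ _ _ (fun x : 'rV[R]_n => (x, x))
  (fun p => dot p.1 p.2) x); first exact: continuous_diag.
exact: polyfun_continuous (@polyfun_dot12 R n) _.
Qed.

Lemma continuous_sqdist U : continuous (@sqdist R n U).
Proof.
move=> x; apply: (@continuous_comp _ _ _ (fun x : 'rV[R]_n => (x, x))
  (fun p => sqdist U p.1) x); first exact: continuous_diag.
exact: polyfun_continuous (@polyfun_sqdist R n U) _.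
Qed.

Lemma compact_unit_sphere (U : {vspace 'rV[R]_n}) :
  compact [set x | x \in U /\ dot x x = 1].
Proof.
apply: bounded_closed_compact.
  exists 1; split => // r r1 x [_ xx]; apply/ltW/(le_lt_trans _ r1).
  have -> : `|x| = mx_norm x by [].
  have [->|/mx_norm_neq0[[i j] ->]] := eqVneq (mx_norm x) 0; first exact: ler01.
  rewrite ord1 /=; have : x 0 j ^+ 2 <= 1.
    by rewrite -xx dotE (bigD1 j) //= -expr2 lerDl sumr_ge0 // => k _; rewrite -expr2 sqr_ge0.
  by rewrite -real_normK ?num_real // expr_le1.
have -> : [set x | x \in U /\ dot x x = 1] =
    (@sqdist R n U) @^-1` [set 0] `&` (fun x => dot x x) @^-1` [set 1].
  by apply/seteqP; split=> x /=; rewrite -sqdist_eq0 => -[/eqP].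
by apply: closedI; apply: closed_comp => // x _;
  [exact: continuous_sqdist|exact: continuous_dot_self].
Qed.

Lemma coll_bigcap S :
  exists b, forall x, x \in X b <-> (forall c, c \in S -> x \in X c).
Proof.
suff [b bP] : exists b, forall x, x \in X b <->
    (forall c, c \in enum S -> x \in X c).
  exists b => x; split=> [/bP xc c cS|xS]; first by apply: xc; rewrite mem_enum.
  by apply/bP => c; rewrite mem_enum; exact: xS.
elim: (enum S) => [|d s [b bP]].
  by exists (idx0 H) => x; rewrite coll_idx0 memvf.
have [b' b'E] := coll_cap d b; exists b' => x; rewrite b'E memv_cap.
split=> [/andP[xd /bP xs] c|xs].
  by rewrite in_cons => /predU1P[->|/xs].
rewrite xs ?mem_head //=; apply/bP => c cs.
by apply: xs; rewrite in_cons cs orbT.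
Qed.

(** If the X_c with c in S meet inside X_a, the sum has no zero on the unit sphere of X^a and
    attains a positive minimum by compactness. The condition on [S] comes after [m], so that an [m]
    exists for every [S] and the least of them serves all. *)
Lemma sum_sqdist_lower a S :
  exists2 m, 0 < m & (forall x, (forall c, c \in S -> x \in X c) -> x \in X a) ->
    forall x, x \in perp (X a) -> dot x x = 1 -> m <= \sum_(c in S) sqdist (X c) x.
Proof.
have [Sa|nSa] := pselect (forall x, (forall c, c \in S -> x \in X c) -> x \in X a);
  last by exists 1 => // /nSa.
pose K := [set x | x \in perp (X a) /\ dot x x = 1].
have [[x0 Kx0]|K0] := pselect (K !=set0); last first.
  by exists 1 => // _ x xa xx; case: K0; exists x.
pose f x := \sum_(c in S) sqdist (X c) x.
have cf : continuous f.
  rewrite /f; elim: (index_enum _) => [|c s IH].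
    by under eq_fun do rewrite big_nil; move=> x; exact: cst_continuous.
  under eq_fun do rewrite big_cons; case: (c \in S) => // x.
  exact: (cvgD (@continuous_sqdist (X c) x) (IH x)).
have [x1 x1K x1min] := @EVT_min_rV R n f K (ex_intro _ x0 Kx0)
  (@compact_unit_sphere (perp (X a))) (continuous_subspaceT cf).
rewrite inE in x1K; exists (f x1); last first.
  by move=> _ x xa xx; apply: x1min; rewrite inE.
have f0 y : 0 <= f y by apply: sumr_ge0 => c _; exact: sqdist_ge0.
rewrite lt_neqAle f0 andbT eq_sym; apply/negP => fx1.
have x1a : x1 \in X a.
  apply: Sa => c cS; rewrite -sqdist_eq0; move: fx1; rewrite psumr_eq0; last first.
    by move=> d _; exact: sqdist_ge0.
  by move=> /allP/(_ c (mem_index_enum c)); rewrite cS.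
have [/mem_perpP/(_ _ x1a)] := x1K; move=> -> /eqP.
by rewrite eq_sym oner_eq0.
Qed.

(* A Lebesgue number for the cover of the unit sphere of X^a by the open sets
   of directions lying on no X_c with c not <= b, b < a. *)
Lemma lebesgue_number a : exists2 d, 0 < d & forall x, x \in perp (X a) ->
  dot x x = 1 -> exists b, [/\ b != a, (X a <= X b)%VS & forall y c,
    dot (y - x) (y - x) <= d -> (X a <= X c)%VS -> y \in X c -> (X b <= X c)%VS].
Proof.
have /fin_all_exists2[m m0 mP] : forall S, exists2 m, 0 < m &
    (forall x, (forall c, c \in S -> x \in X c) -> x \in X a) ->
    forall x, x \in perp (X a) -> dot x x = 1 -> m <= \sum_(c in S) sqdist (X c) x.
  by move=> S; exact: sum_sqdist_lower.
have [mm mm0 mmS] := finite_lower_bound m0.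
(* At most [#|idx H|] terms of this size sum to less than [mm]. *)
exists (mm / (#|idx H|.+1)%:R); first by rewrite divr_gt0.
move=> x xa xx; set d := mm / _.
(* The index [b] belongs to the intersection of the X_c that contain X_a and pass near [x]. Were
   this X_a, the squared distances would sum to at least [mm]. *)
pose S : {set idx H} := [set c | (X a <= X c)%VS && (sqdist (X c) x <= d)]%SET.
have [b bP] := coll_bigcap S.
have ab : (X a <= X b)%VS.
  apply/subvP => y ya; apply/bP => c; rewrite inE => /andP[/subvP ac _].
  exact: ac.
exists b; split=> //.
  apply/eqP => ba; have Sa y : (forall c, c \in S -> y \in X c) -> y \in X a.
    by move=> /bP; rewrite ba.
  have := le_trans (mmS S) (mP S Sa x xa xx); apply/negP; rewrite -ltNge.
  apply: (@le_lt_trans _ _ (\sum_(c in S) d)).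
    by apply: ler_sum => c; rewrite inE => /andP[].
  rewrite sumr_const -mulr_natr /d -mulrA gtr_pMr // mulrC ltr_pdivrMr ?ltr0n //.
  by rewrite mul1r ltr_nat ltnS max_card.
(* A point of X_c near [x] bounds the distance from [x] to X_c, which puts [c] into [S]. *)
move=> y c yx ac yc; apply/subvP => z /bP; apply; rewrite inE ac /=.
apply: le_trans yx; rewrite /sqdist.
have -> : x - oproj (X c) x = - ((y - x) - oproj (X c) (y - x)).
  have -> : oproj (X c) (y - x) = y - oproj (X c) x by rewrite linearB /= (oproj_id yc).
  by rewrite opprB opprB [RHS]addrC addrA subrK.
rewrite dotNl dotNr opprK dot_sub_oproj lerBlDr lerDl; exact: dot_ge0.
Qed.

End LebesgueNumber.

(** * Bounds on the number of breaks *)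

(** The supremum of the zeros is itself a zero, by continuity. *)
Lemma last_zero (R : realType) (f : R -> R) (p q : R) : p <= q ->
  {within `[p, q], continuous f} -> (forall r, p <= r <= q -> 0 <= f r) ->
  f p = 0 -> 0 < f q ->
  exists z, [/\ p <= z, z < q, f z = 0 & forall r, z < r <= q -> 0 < f r].
Proof.
move=> pq cf f0 fp fq; pose S := [set r | p <= r <= q /\ f r = 0].
have Sp : S p by rewrite /S /= lexx.
have supS : has_sup S by split; [exists p|exists q => r [/andP[]]].
have ubS r : S r -> r <= sup S by move=> Sr; exact: (ub_le_sup supS.2 Sr).
have pz : p <= sup S by exact: ubS.
have zq : sup S <= q by apply: ge_sup; [exists p|move=> r [/andP[]]].
have fz : f (sup S) = 0.
  apply: contrapT => /eqP fz.
  have zpq : `[p, q]%classic (sup S) by rewrite /= in_itv /= pz.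
  have /subspace_continuousP/(_ _ zpq)/cvgrPdist_lt/(_ `|f (sup S)|) := cf.
  rewrite normr_gt0 => /(_ fz) near_z.
  have {near_z}/nbhs_ballP[e e0 he] : \forall r \near sup S, `[p, q]%classic r ->
    `|f (sup S) - f r| < `|f (sup S)| by [].
  have [s Ss es] := sup_adherent e0 supS.
  have [spq fs] := Ss.
  have sb : ball (sup S) e s.
    by rewrite /ball /= ger0_norm ?subr_ge0 ?ubS //; move: es; lra.
  by have := he s sb; rewrite /= in_itv /= => /(_ spq); rewrite fs subr0 ltxx.
exists (sup S); split=> //.
  by rewrite lt_neqAle zq andbT; apply: contraTneq fq => <-; rewrite fz ltxx.
move=> r /andP[zr rq]; have pr : p <= r by rewrite (le_trans pz) // ltW.
rewrite lt_neqAle f0 ?pr // andbT eq_sym; apply/eqP => fr.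
have Sr : S r by rewrite /S /= pr.
by have := ubS r Sr; rewrite leNgt zr.
Qed.

Lemma first_zero (R : realType) (f : R -> R) (p q : R) : p <= q ->
  {within `[p, q], continuous f} -> (forall r, p <= r <= q -> 0 <= f r) ->
  f q = 0 -> 0 < f p ->
  exists z, [/\ p < z, z <= q, f z = 0 & forall r, p <= r < z -> 0 < f r].
Proof.
move=> pq cf f0 fq fp.
have cg : {within `[- q, - p], continuous (fun r => f (- r))}.
  apply/subspace_continuousP => x; rewrite /= in_itv /= => /andP[qx xp].
  have mem : `[p, q]%classic (- x) by rewrite /= in_itv /= lerNr xp lerNl qx.
  apply/cvgrPdist_lt => e e0.
  have /subspace_continuousP/(_ _ mem)/cvgrPdist_lt/(_ e e0) ne := cf.
  have {ne}/nbhs_ballP[d d0 hd] : \forall r \near (- x), `[p, q]%classic r ->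
    `|f (- x) - f r| < e by [].
  suff: \forall r \near x, `[- q, - p]%classic r -> `|f (- x) - f (- r)| < e by [].
  apply/nbhs_ballP; exists d => // r; rewrite /ball /= => xr.
  rewrite in_itv /= => /andP[qr rp]; apply: hd.
    by rewrite /ball /= -opprD normrN.
  by rewrite /= in_itv /= lerNr rp lerNl qr.
have g0 r : - q <= r <= - p -> 0 <= f (- r).
  by move=> /andP[qr rp]; apply: f0; rewrite lerNr rp lerNl qr.
have qp : - q <= - p by rewrite lerN2.
have gq : f (- - q) = 0 by rewrite opprK.
have gp : 0 < f (- - p) by rewrite opprK.
have [z [z1 z2 fz zr]] := last_zero qp cg g0 gq gp.
exists (- z); split; rewrite ?opprK //.
- by rewrite ltrNr.
- by rewrite lerNl.
- move=> r /andP[pr rz]; have := zr (- r); rewrite opprK; apply.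
  by rewrite ltrNr rz lerN2.
Qed.

Lemma seq_isolated (R : realType) (s : seq R) (r : R) :
  exists2 e, 0 < e & forall x, x \in s -> `|x - r| < e -> x = r.
Proof.
elim: s => [|y s [e e0 es]]; first by exists 1.
have [->|yr] := eqVneq y r.
  by exists e => // x; rewrite in_cons => /predU1P[//|]; exact: es.
have yr0 : 0 < `|y - r| by rewrite normr_gt0 subr_eq0.
exists (Num.min e `|y - r|); first by rewrite lt_min e0.
move=> x; rewrite in_cons lt_min => /predU1P[-> /andP[_]|xs /andP[xe _]].
  by rewrite ltxx.
exact: es.
Qed.

Section BreakBound.
Variables (R : realType) (n : nat) (H : many_body R n).
Local Notation X := (@coll R n H).
Implicit Types (a b : idx H) (M : nat).

Definition face_breaks (gamma : R -> 'rV[R]_n * 'rV[R]_n) K s :=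
  breaks_in (fun t => face_idx H (gamma t).1) K s.

(** The bound is uniform in [l], [J] and [gamma]. In the induction only [K] shrinks while the curve
    keeps its domain [J], so derivatives relative to [J] remain those of one fixed interval. *)
Definition breaks_bound a M := forall l J gamma, is_interval J ->
  gen_broken_bichar H l J gamma -> forall K, K `<=` J -> is_interval K ->
  (forall t, K t -> (X a <= X (face_idx H (gamma t).1))%VS) ->
  exists s, (size s <= M)%N /\ face_breaks gamma K s.

Lemma breaks_boundW a M N : (M <= N)%N -> breaks_bound a M -> breaks_bound a N.
Proof.
move=> MN aM l J gamma iJ G K KJ iK aK.
by have [s [sM sK]] := aM l J gamma iJ G K KJ iK aK; exists s; rewrite (leq_trans sM).
Qed.

Section Step.
Variables (E : seq R) (EP : forall e, thresholds H e -> e \in E).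
Variables (a : idx H) (M : nat).
Hypothesis IH : forall b, (X a <= X b)%VS -> b != a -> breaks_bound b M.
Variables (l : R) (J : set R) (gamma : R -> 'rV[R]_n * 'rV[R]_n).
Hypothesis iJ : is_interval J.
Hypothesis G : gen_broken_bichar H l J gamma.
Local Notation W t := (gamma t).1.
Local Notation Xi t := (gamma t).2.
Local Notation A t := (face_idx H (W t)).
Local Notation eta t := (dot (W t) (Xi t)).
Local Notation rad2 := (rad2 gamma a).

Lemma rad2_ge0 t : J t -> 0 <= rad2 t.
Proof. by move=> Jt; rewrite (rad2E G a Jt) sqdist_ge0. Qed.

Lemma rad2_eq0 t : J t -> (X a <= X (A t))%VS -> (rad2 t == 0) = (A t == a).
Proof.
move=> Jt aA; rewrite (rad2E G a Jt) sqdist_eq0.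
rewrite -(face_idx_min a (bichar_unit G Jt)); apply/idP/eqP => [Aa|-> //].
by apply/coll_inj/eqP; rewrite eqEsubv Aa.
Qed.

Variables (x0 : 'rV[R]_n).
Local Notation radvel := (radvel gamma a x0).
Local Notation dirdot := (dirdot gamma a).
Local Notation arcsum := (arcsum E l gamma a x0).

Section Interval.
Variable K : set R.
Hypotheses (KJ : K `<=` J) (iK : is_interval K).
Hypothesis aK : forall t, K t -> (X a <= X (A t))%VS.
Hypothesis x0K : forall t, K t -> oproj (X a) (Xi t) = x0.
Hypothesis rK : forall t, K t -> 0 < rad2 t.

Let face_neq t : K t -> A t != a.
Proof. by move=> Kt; rewrite -rad2_eq0 ?aK // ?gt_eqF ?rK //; exact: KJ. Qed.

(** A relation that composes over adjacent intervals and so passes across breaks. Used for [v] and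
    for its opposite, it bounds the displacement of theta. *)
Let mono_rel t u := radvel t <= radvel u /\
  forall v, dot v v = 1 -> dirdot v u - dirdot v t <= arcsum u - arcsum t.

Let mono_piece t u : K t -> K u -> t <= u ->
  (forall s, t < s < u -> A s = A ((t + u) / 2)) -> mono_rel t u.
Proof.
move=> Kt Ku; rewrite le_eqVlt => /predU1P[<- _|tu Ac].
  by split=> // v _; rewrite !subrr.
have Kin s : t <= s <= u -> K s by exact: iK Kt Ku s.
have ac : (X a <= X (A ((t + u) / 2)))%VS.
  by apply/aK/Kin; rewrite !ltW ?midf_lt.
have x0E s : t <= s <= u -> oproj (X a) (Xi s) = x0 by move=> /Kin/x0K.
have r0 s : t <= s <= u -> 0 < rad2 s by move=> /Kin/rK.
split=> [|v vv].
  exact: (radvel_piece_le G iJ (KJ Kt) (KJ Ku) tu Ac ac x0E r0).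
exact: (dirdot_piece_le EP G iJ (KJ Kt) (KJ Ku) tu Ac ac x0E r0).
Qed.

(** Near a time [r] the index is at most its value at [r], which is below a off the axis, so by [IH]
    there are finitely many breaks near [r]. Short intervals on either side of [r] then have
    constant index inside, and [mono_piece] applies up to [r]. *)
Lemma radvel_dirdot_le t u : K t -> K u -> t <= u -> mono_rel t u.
Proof.
move=> Kt Ku tu; apply: (@local_to_global R mono_rel) => //.
  move=> x y z _ _ _ _ [xy xyd] [yz yzd]; split=> [|v vv].
    exact: le_trans xy yz.
  by have := xyd v vv; have := yzd v vv; lra.
move=> r rtu; have Kr : K r by exact: iK Kt Ku r rtu.
have /nbhs_ballP[e1 e10 near1] := bichar_face_near G (KJ Kr).
pose K' := K `&` [set s | `|s - r| < e1].
have K'J : K' `<=` J by move=> s [/KJ].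
have iK' : is_interval K'.
  move=> x y [Kx xr] [Ky yr] z /andP[xz zy]; split.
    by apply: (iK Kx Ky); rewrite xz.
  by move: xr yr; rewrite /= !ltr_norml => /andP[x1 x2] /andP[y1 y2]; apply/andP; split; lra.
have bK' s : K' s -> (X (A r) <= X (A s))%VS.
  move=> [Ks sr]; apply: near1; last exact: KJ.
  by rewrite /ball /= distrC.
have [s [_ sK']] := IH (aK Kr) (face_neq Kr) iJ G K'J iK' bK'.
have [e2 e20 iso] := seq_isolated s r.
exists (Num.min e1 e2); first by rewrite lt_min e10.
have const p q : K' p -> K' q -> p <= q -> (forall x, p <= x <= q -> x != r /\ `|x - r| < e2) ->
    A p = A q.
  move=> Kp Kq pq pqr; apply: (sK' p q) => // x xs; apply/negP => /pqr[/eqP xr xe].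
  by apply: xr; exact: iso.
have const_oo p q : K' p -> K' q -> p <= q -> (r <= p \/ q <= r) -> `|p - r| < e2 ->
    `|q - r| < e2 -> forall s, p < s < q -> A s = A ((p + q) / 2).
  move=> Kp Kq pq pqr pe qe.
  have H1 x y : p < x -> x <= y -> y < q -> A x = A y.
    move=> px xy yq; apply: const => //.
    - by apply: (iK' _ _ Kp Kq); apply/andP; split; lra.
    - by apply: (iK' _ _ Kp Kq); apply/andP; split; lra.
    - move=> z /andP[xz zy]; split.
        by apply/eqP => zr; case: pqr => h; lra.
      by move: pe qe; rewrite !ltr_norml => /andP[? ?] /andP[? ?]; apply/andP; split; lra.
  move=> z /andP[pz zq]; have [m1 m2] := midf_lt (lt_trans pz zq).
  by have [zm|/ltW mz] := leP z ((p + q) / 2); [exact: H1|apply/esym; exact: H1].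
move=> u' /(iK Kt Ku) Ku'; rewrite lt_min => /andP[u1 u2].
have K'r : K' r by split=> //; rewrite /= subrr normr0.
have K'u : K' u' by split.
have rr : `|r - r| < e2 by rewrite subrr normr0.
split=> le.
- by apply: mono_piece => //; apply: const_oo => //; right.
- by apply: mono_piece => //; apply: const_oo => //; left.
Qed.

(** As [arcsum] stays within 4 #E of 0, the shifted and rescaled [B] has values in [0, N[. It is
    nondecreasing, and its integer part cuts [K] into at most [N] intervals on which theta moves by
    at most [d]. *)
Lemma breaks_off_axis (d : R) (N : nat) : 0 < d ->
  (forall x, x \in perp (X a) -> dot x x = 1 -> exists b,
     [/\ b != a, (X a <= X b)%VS & forall y c,
       dot (y - x) (y - x) <= d ^+ 2 -> (X a <= X c)%VS -> y \in X c -> (X b <= X c)%VS]) ->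
  8 * (size E)%:R < d * N%:R ->
  exists s, (size s <= N * M.+1)%N /\ face_breaks gamma K s.
Proof.
move=> d0 leb EN.
pose B t := (arcsum t + 4 * (size E)%:R) / d.
have B0 t : 0 <= B t.
  rewrite divr_ge0 ?(ltW d0) //.
  by have := arcsum_bound E l gamma a x0 t; rewrite ler_norml => /andP[]; lra.
pose k t := Num.truncn (B t).
have Bmono t u : K t -> K u -> t <= u -> B t <= B u.
  move=> Kt Ku tu; rewrite ler_pM2r ?invr_gt0 // lerD2r.
  exact/arcsum_mono/(radvel_dirdot_le Kt Ku tu).1.
apply: (@breaks_in_partition _ _ _ K k N M).
- move=> t Kt; rewrite -(ltr_nat R).
  have /andP[h _] := truncn_itv (B0 t); apply: le_lt_trans h _.
  rewrite /B ltr_pdivrMr // [_ * d]mulrC; apply: le_lt_trans EN.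
  by have := arcsum_bound E l gamma a x0 t; rewrite ler_norml => /andP[_]; lra.
- by move=> t u Kt Ku tu; apply: le_truncn; exact: Bmono.
move=> i iN; pose Ki := K `&` [set t | k t = i].
have [[t0 [Kt0 kt0]]|no] := pselect (Ki !=set0); last first.
  by exists [::]; split=> // t u Kt; case: no; exists t.
have close t u : Ki t -> Ki u -> arcsum u - arcsum t <= d.
  move=> [_ kt] [_ ku].
  have /andP[h1 _] := truncn_itv (B0 t); have /andP[_ h2] := truncn_itv (B0 u).
  move: h1 h2; rewrite -/(k t) -/(k u) kt ku /B => h1 h2.
  rewrite ler_pdivlMr // in h1; rewrite ltr_pdivrMr // in h2.
  by move: h2; rewrite -natr1 mulrDl mul1r; lra.
pose th t := (rad gamma a t)^-1 *: (W t - oproj (X a) (W t)).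
have dth v t : dot v (th t) = dirdot v t.
  by rewrite /th dotZr mulrC /dirdot dotBr -dot_oprojC -dotBl.
have rad0 t : K t -> 0 < rad gamma a t by move=> Kt; rewrite sqrtr_gt0 rK.
have dthle t u v : Ki t -> Ki u -> dot v v = 1 -> dot v (th u - th t) <= d.
  move=> Kt Ku vv; rewrite dotBr !dth.
  have [tu|/ltW ut] := leP t u.
    apply: le_trans (close _ _ Kt Ku).
    by apply: (radvel_dirdot_le _ _ tu).2 => //; [exact: Kt.1|exact: Ku.1].
  apply: le_trans (close _ _ Ku Kt).
  (* For times in the opposite order the bound is used with the opposite vector. *)
  have := (radvel_dirdot_le Ku.1 Kt.1 ut).2 (- v); rewrite dotNl dotNr opprK => /(_ vv).
  by rewrite -!dth !dotNl; lra.
have th_perp t : th t \in perp (X a) by rewrite rpredZ // sub_oproj_perp.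
have th_unit t : K t -> dot (th t) (th t) = 1.
  move=> Kt; rewrite /th dotZl dotZr -/(sqdist (X a) (W t)) -(rad2E G a (KJ Kt)).
  have <- : rad gamma a t ^+ 2 = rad2 t by rewrite sqr_sqrtr // ltW // rK.
  by field; rewrite gt_eqF ?rad0.
have [b [ba ab bc]] := leb _ (th_perp t0) (th_unit t0 Kt0).
have KiJ : Ki `<=` J by move=> t [/KJ].
have iKi : is_interval Ki.
  move=> x y [Kx kx] [Ky ky] z xzy; have Kz := iK Kx Ky xzy; split=> //.
  move: xzy => /andP[xz zy]; rewrite /=; apply/eqP; rewrite eqn_leq.
  rewrite -{1}ky -kx; apply/andP; split; apply: le_truncn; exact: Bmono.
apply: (IH ab ba iJ G KiJ iKi) => t Kt.
apply: (bc (th t)); [|exact: (aK Kt.1)|].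
  by apply: dot_sup_unit; [exact: ltW|move=> v vv; apply: dthle => //; split].
rewrite rpredZ // rpredB //; first by apply: mem_face_idx; apply: (bichar_unit G); exact: KiJ.
by apply: (subvP (aK Kt.1)); exact: oproj_mem.
Qed.

End Interval.

End Step.

End BreakBound.

Section BreakBoundExists.
Variables (R : realType) (n : nat) (H : many_body R n).
Variables (E : seq R) (EP : forall e, thresholds H e -> e \in E).
Local Notation X := (@coll R n H).
Implicit Types (a b : idx H) (M : nat).

Section AxisConvex.
Variables (a : idx H) (M : nat).
Hypothesis IH : forall b, (X a <= X b)%VS -> b != a -> breaks_bound b M.
Variables (l : R) (J : set R) (gamma : R -> 'rV[R]_n * 'rV[R]_n).
Hypothesis iJ : is_interval J.
Hypothesis G : gen_broken_bichar H l J gamma.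
Local Notation W t := (gamma t).1.
Local Notation Xi t := (gamma t).2.
Local Notation A t := (face_idx H (W t)).
Local Notation eta t := (dot (W t) (Xi t)).
Local Notation rad2 := (rad2 gamma a).
Variables (x0 : 'rV[R]_n) (K : set R).
Local Notation radvel := (radvel gamma a x0).
Local Notation radmom := (radmom gamma x0).
Hypotheses (KJ : K `<=` J) (iK : is_interval K).
Hypothesis aK : forall t, K t -> (X a <= X (A t))%VS.
Hypothesis x0K : forall t, K t -> oproj (X a) (Xi t) = x0.

(* Between two zeros of |y| the radial momentum is monotone, so it has a constant
   sign on one side of any intermediate point, and Gronwall applies there. *)
Lemma rad2_axis_convex t1 t t2 : K t1 -> K t2 -> t1 <= t <= t2 ->
  rad2 t1 = 0 -> rad2 t2 = 0 -> rad2 t = 0.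
Proof.
move=> Kt1 Kt2 /andP[t1t tt2] z1 z2; have Kt : K t by apply: (iK Kt1 Kt2); rewrite t1t.
have K12 p : t1 <= p <= t2 -> K p by exact: iK Kt1 Kt2 p.
apply/eqP; rewrite eq_le (rad2_ge0 a G (KJ Kt)) andbT leNgt; apply/negP => rt.
have cr p q : K p -> K q -> {within `[p, q], continuous rad2}.
  move=> Kp Kq; have sub : `[p, q]%classic `<=` J.
    by move=> r /(segment_sub iK Kp Kq)/KJ.
  by apply: (continuous_subspaceW sub); exact: within_rad2 G a.
have r_ge0 p q : K p -> K q -> forall r, p <= r <= q -> 0 <= rad2 r.
  by move=> Kp Kq r prq; apply: (rad2_ge0 a G); apply: KJ; exact: iK Kp Kq r prq.
have [p [t1p pt zp posp]] := last_zero t1t (cr _ _ Kt1 Kt) (r_ge0 _ _ Kt1 Kt) z1 rt.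
have [q [tq qt2 zq posq]] := first_zero tt2 (cr _ _ Kt Kt2) (r_ge0 _ _ Kt Kt2) z2 rt.
have Kp : K p by apply: K12; apply/andP; split; lra.
have Kq : K q by apply: K12; apply/andP; split; lra.
pose K' := `]p, q[%classic.
have K'E s : K' s <-> p < s < q by rewrite /K' /= in_itv.
have K'K s : K' s -> K s.
  by move=> /K'E/andP[ps sq]; apply: (iK Kp Kq); rewrite !ltW.
have K'J : K' `<=` J by move=> s /K'K/KJ.
have iK' : is_interval K'.
  move=> x y /K'E/andP[px _] /K'E/andP[_ yq] z /andP[xz zy]; apply/K'E.
  by rewrite (lt_le_trans px xz) (le_lt_trans zy yq).
have rK' s : K' s -> 0 < rad2 s.
  move=> /K'E/andP[ps sq]; have [st|/ltW ts] := leP s t.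
    by apply: posp; rewrite ps.
  by apply: posq; rewrite ts.
have mono s u : K' s -> K' u -> s <= u -> radvel s <= radvel u.
  move=> Ks Ku su; apply: (radvel_dirdot_le EP IH iJ G K'J iK' _ _ rK' Ks Ku su).1.
  - by move=> r /K'K; exact: aK.
  - by move=> r /K'K; exact: x0K.
have [C C0 etaC] := eta_bound EP G.
have D s : p < s < q -> is_derive s 1 rad2 (4 * (radmom s - eta s * rad2 s)).
  move=> psq; have Ks : K s by apply: K'K; apply/K'E.
  apply: (is_derive_rad2 G (KJ Ks)); [|exact: aK|exact: x0K].
  exact: (interval_near iJ (KJ Kp) (KJ Kq) psq).
have etar s : p < s < q -> - (C * rad2 s) <= eta s * rad2 s <= C * rad2 s.
  move=> /K'E Ks; have := etaC s (K'J s Ks); rewrite ler_norml => /andP[e1 e2].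
  have r0 := ltW (rK' s Ks); apply/andP; split; last by rewrite ler_wpM2r.
  by rewrite -mulNr ler_wpM2r.
have momE s : p < s < q -> radmom s = radvel s * rad gamma a s.
  by move=> /K'E Ks; rewrite /radvel divfK // gt_eqF // sqrtr_gt0 rK'.
have Kt' : K' t by apply/K'E; rewrite pt.
suff : rad2 t <= 0 by rewrite leNgt rt.
have [v0|/ltW v0] := leP (radvel t) 0.
- apply: (@gronwall_le0 R rad2 (fun s => 4 * (radmom s - eta s * rad2 s)) (4 * C) p t).
  + exact: ltW.
  + exact: cr.
  + by move=> s /andP[ps st]; apply: D; rewrite ps (lt_trans st).
  + move=> s /andP[ps st]; have psq : p < s < q by rewrite ps (lt_trans st).
    have : radmom s <= 0.
      rewrite momE // mulr_le0_ge0 ?sqrtr_ge0 //.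
      by apply: le_trans v0; apply: mono => //; exact: ltW.
    by have /andP[] := etar s psq; lra.
  + by rewrite zp.
- apply: (@gronwall_back_le0 R rad2 (fun s => 4 * (radmom s - eta s * rad2 s)) (4 * C) t q).
  + exact: ltW.
  + exact: cr.
  + by move=> s /andP[ts sq]; apply: D; rewrite sq (lt_trans pt).
  + move=> s /andP[ts sq]; have psq : p < s < q by rewrite sq (lt_trans pt).
    have : 0 <= radmom s.
      rewrite momE // mulr_ge0 ?sqrtr_ge0 //.
      by apply: le_trans v0 _; apply: mono => //; exact: ltW.
    by have /andP[] := etar s psq; lra.
  + by rewrite zq.
Qed.

End AxisConvex.

(** The function [k] is 0 before the axis is met, 1 on it and 2 afterwards, and is nondecreasing
    because the axis times form an interval. On the axis the index does not change;
    [breaks_off_axis] treats the two other pieces. *)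
Lemma breaks_bound_step a M :
  (forall b, (X a <= X b)%VS -> b != a -> breaks_bound b M) ->
  exists M', breaks_bound a M'.
Proof.
move=> IH; have [d0 d00 leb] := lebesgue_number a.
pose d := Num.sqrt d0; have d_gt0 : 0 < d by rewrite sqrtr_gt0.
have d2 : d ^+ 2 = d0 by rewrite sqr_sqrtr // ltW.
rewrite -d2 in leb.
have m0 : 0 <= 8 * (size E)%:R / d by rewrite divr_ge0 ?(ltW d_gt0) // mulr_ge0.
pose N := (Num.truncn (8 * (size E)%:R / d)).+1.
have EN : 8 * (size E)%:R < d * N%:R.
  by have /andP[_] := truncn_itv m0; rewrite ltr_pdivrMr // [_ * d]mulrC.
(* Three pieces with at most [N * M.+1] breaks each, and one further point for the end of each
   piece. *)
exists (3 * (N * M.+1).+1)%N => l J gamma iJ G K KJ iK aK.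
have [[t0 Kt0]|K0] := pselect (K !=set0); last first.
  by exists [::]; split=> // t u Kt; case: K0; exists t.
pose x0 := oproj (X a) (gamma t0).2.
have x0K t : K t -> oproj (X a) (gamma t).2 = x0.
  move=> Kt; have [tt0|/ltW t0t] := leP t t0.
    apply: (bichar_oproj_const G iJ (KJ _ Kt) (KJ _ Kt0) tt0) => s sI.
    exact/aK/(iK _ _ Kt Kt0).
  apply/esym/(bichar_oproj_const G iJ (KJ _ Kt0) (KJ _ Kt) t0t) => s sI.
  exact/aK/(iK _ _ Kt0 Kt).
have conv := rad2_axis_convex IH iJ G KJ iK aK x0K.
pose past t := `[< exists u, [/\ K u, rad2 gamma a u = 0 & u < t] >].
pose k t := if rad2 gamma a t == 0 then 1%N else if past t then 2%N else 0%N.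
have kmono t u : K t -> K u -> t <= u -> (k t <= k u)%N.
  move=> Kt Ku tu; rewrite /k; have [zt|nzt] := eqVneq (rad2 gamma a t) 0.
    have [//|nzu] := eqVneq (rad2 gamma a u) 0.
    suff -> : past u by [].
    apply/asboolP; exists t; split=> //; rewrite lt_neqAle tu andbT.
    by apply: contraNneq nzu => <-; rewrite zt.
  have [|//] := boolP (past t) => /asboolP[s [Ks zs st]].
  have pu : past u by apply/asboolP; exists s; split=> //; exact: lt_le_trans st tu.
  rewrite pu; have [zu|//] := eqVneq (rad2 gamma a u) 0.
  have stu : s <= t <= u by rewrite ltW.
  by rewrite (conv _ _ _ Ks Ku stu zs zu) eqxx in nzt.
apply: (@breaks_in_partition _ _ _ K k 3 (N * M.+1)%N) => //.
  by move=> t Kt; rewrite /k; case: ifP => // _; case: ifP.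
move=> i i3; pose Ki := K `&` [set t | k t = i].
have KiK : Ki `<=` K by move=> t [].
have [->|i1] := eqVneq i 1%N.
  exists [::]; split=> // t u [Kt kt] [Ku ku] _ _.
  have Aa s : K s -> k s = 1%N -> face_idx H (gamma s).1 = a.
    move=> Ks; rewrite /k; case: ifPn => [|_]; last by case: ifP.
    by rewrite (rad2_eq0 G (KJ _ Ks) (aK _ Ks)) => /eqP.
  by rewrite (Aa t) // (Aa u).
have iKi : is_interval Ki.
  move=> x y [Kx kx] [Ky ky] z xzy; have Kz := iK _ _ Kx Ky z xzy; split=> //.
  move: xzy => /andP[xz zy]; rewrite /=; apply/eqP; rewrite eqn_leq.
  by rewrite -{1}ky -kx; apply/andP; split; apply: kmono.
have rKi t : Ki t -> 0 < rad2 gamma a t.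
  move=> [Kt kt]; rewrite lt_neqAle (rad2_ge0 a G (KJ _ Kt)) andbT eq_sym.
  by apply: contraNneq i1 => zt; rewrite -kt /k zt eqxx.
have KiJ : Ki `<=` J by move=> t /KiK/KJ.
apply: (breaks_off_axis EP IH iJ G KiJ iKi _ _ rKi d_gt0 leb EN) => t /KiK.
- exact: aK.
- exact: x0K.
Qed.

(** Strong induction on the codimension of X_a, which is smaller for b < a. When X_a is the whole
    space there is no such b and the curve is always on the axis. The sum over the finitely many b
    gives one constant for all. *)
Lemma breaks_bound_ex a : exists M, breaks_bound a M.
Proof.
have [k] := ubnP (n - \dim (X a))%N; elim: k a => // k IHk a; rewrite ltnS => ak.
have /fin_all_exists[M MP] : forall b, exists M,
    (X a <= X b)%VS -> b != a -> breaks_bound b M.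
  move=> b; have [/andP[ab ba]|nab] := boolP ((X a <= X b)%VS && (b != a)); last first.
    by exists 0%N => ab ba; rewrite ab ba in nab.
  have [|M bM] := IHk b; last by exists M.
  apply: leq_trans ak; apply: ltn_sub2l.
    apply: (@leq_trans (\dim (X b))); last first.
      by have := dimvS (subvf (X b)); rewrite dimvf /dim /= mul1n.
    rewrite ltn_neqAle dimvS // andbT; apply: contra ba => /eqP dimE.
    by apply/eqP/coll_inj/esym/eqP; rewrite eqEdim ab dimE leqnn.
  rewrite ltn_neqAle dimvS // andbT; apply: contra ba => /eqP dimE.
  by apply/eqP/coll_inj/esym/eqP; rewrite eqEdim ab dimE leqnn.
apply: (@breaks_bound_step a (\sum_b M b)%N) => b ab ba.
by apply: breaks_boundW (MP b ab ba); rewrite (bigD1 b) //= leq_addr.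
Qed.

End BreakBoundExists.

(** * Unbroken pieces *)

Section Unbroken.
Variables (R : realType) (n : nat) (H : many_body R n).
Variables (l : R) (J : set R) (gamma : R -> 'rV[R]_n * 'rV[R]_n).
Hypothesis G : gen_broken_bichar H l J gamma.
Hypothesis iJ : is_interval J.
Local Notation X := (@coll R n H).
Local Notation W t := (gamma t).1.
Local Notation Xi t := (gamma t).2.
Local Notation A t := (face_idx H (W t)).
Implicit Types (K : set R) (t u x y : R) (v : 'rV[R]_n).

Lemma unbroken_sub K L : L `<=` K -> unbroken H K gamma -> unbroken H L gamma.
Proof.
move=> LK [c [cK cg]]; exists c; split=> [t Lt|t /LK]; last exact: cg.
have [ct lim] := cK t (LK t Lt); split=> //.
by apply: cvg_trans lim; apply: cvg_app; exact: within_subset.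
Qed.

Lemma bichar_proj t : J t -> gamma t = Defs.proj H (gamma t).
Proof.
move=> Jt; rewrite projE ?(bichar_unit G Jt) // (oproj_id (bichar_mem G Jt)).
exact: surjective_pairing.
Qed.

(** With at most one point in [K] the punctured filter within [K] is trivial, and the limit
    condition holds for any curve. *)
Lemma unbroken_trivial K : K `<=` J -> (forall t u, K t -> K u -> t = u) ->
  unbroken H K gamma.
Proof.
move=> KJ triv; exists gamma; split=> [t Kt|t Kt]; last exact/bichar_proj/KJ.
split=> [|U _]; first exact/(bichar_unit G)/KJ.
suff: \forall s \near t, s != t -> K s ->
    U ((s - t)^-1 *: (gamma s - gamma t)) by [].
apply/nbhs_ballP; exists 1 => //= s _ /eqP st Ks; case: st; exact: triv.
Qed.

Lemma cvg_rowP (F : set_system R) (f : R -> 'rV[R]_n) (w : 'rV[R]_n) : Filter F ->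
  (forall i e, 0 < e -> \forall s \near F, `|w 0 i - f s 0 i| < e) -> f @ F --> w.
Proof.
move=> FF fw; apply/cvgrPdist_lt => e e0.
have : \forall s \near F, forall i, `|w 0 i - f s 0 i| < e.
  by apply: filter_forall => i; exact: fw.
apply: filterS => s sw.
have -> : `|w - f s| = mx_norm (w - f s) by [].
have [->|/mx_norm_neq0[[i j] ->]] := eqVneq (mx_norm (w - f s)) 0; first exact: e0.
by rewrite ord1 /= !mxE.
Qed.

Section Nontrivial.
Variable K : set R.
Hypotheses (KJ : K `<=` J) (iK : is_interval K).
Hypothesis constA : forall p q x y, K p -> K q -> p < x -> x <= y -> y < q -> A x = A y.
Variables (p0 q0 : R).
Hypotheses (Kp0 : K p0) (Kq0 : K q0) (pq0 : p0 < q0).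

Let mid := (p0 + q0) / 2.
Let xi := Xi mid.

Let between p q x : K p -> K q -> p < x < q -> K x.
Proof. by move=> Kp Kq /andP[px xq]; apply: (iK Kp Kq); rewrite !ltW. Qed.

Let Kmid : K mid.
Proof. by apply: (between Kp0 Kq0); rewrite !midf_lt. Qed.

Let interiorE p q x : K p -> K q -> p < x < q -> A x = A mid /\ Xi x = xi.
Proof.
move=> Kp Kq /[dup] pxq /andP[px xq]; have Kx := between Kp Kq pxq.
have [pm mq] := midf_lt pq0.
have [xm|/ltW mx] := leP x mid.
  have Ac s : x <= s <= mid -> A s = A mid.
    by move=> /andP[xs sm]; apply: (constA Kp Kq0) => //; exact: lt_le_trans px xs.
  have Ax := Ac x; rewrite lexx xm in Ax; have {}Ax := Ax isT.
  split=> //; have Xx := bichar_mem G (KJ Kx); rewrite Ax in Xx.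
  rewrite -(oproj_id Xx) -[RHS](oproj_id (bichar_mem G (KJ Kmid))).
  by apply: (bichar_oproj_const G iJ) => //; [exact: KJ..|move=> s /Ac ->].
have Ac s : mid <= s <= x -> A s = A mid.
  move=> /andP[ms sx]; apply/esym; apply: (constA Kp0 Kq) => //.
  exact: le_lt_trans sx xq.
have Ax := Ac x; rewrite lexx mx in Ax; have {}Ax := Ax isT.
split=> //; have Xx := bichar_mem G (KJ Kx); rewrite Ax in Xx.
rewrite -(oproj_id Xx) -[RHS](oproj_id (bichar_mem G (KJ Kmid))).
apply/esym; apply: (bichar_oproj_const G iJ) => //; [exact: KJ..|by move=> s /Ac ->].
Qed.

Let velocity v r := 2 * (dot v xi - dot xi (W r) * dot v (W r)).

Let derive_dotW p q v x : K p -> K q -> p < x < q ->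
  is_derive x 1 (fun r => dot v (W r)) (velocity v x).
Proof.
move=> Kp Kq pxq; have [Ax Xx] := interiorE Kp Kq pxq.
rewrite /velocity (dotC xi) -Xx.
have Jx := KJ (between Kp Kq pxq).
apply: (bichar_derive_dot1_near G) => //.
  exact: (interval_near iJ (KJ Kp) (KJ Kq) pxq).
have : \forall r \near x, r \in `]p, q[ by apply: near_in_itvoo; rewrite in_itv.
apply: filterS => r; rewrite in_itv /= => prq.
by rewrite (interiorE Kp Kq prq).1 Ax.
Qed.

(* At an endpoint of K the value of Xi is recovered from the interior because
   xi_a is continuous there. *)
Let endpoint t : K t -> oproj (X (A t)) xi = Xi t.
Proof.
move=> Kt; have Jt := KJ Kt; rewrite -(oproj_id (bichar_mem G Jt)).
apply: dot_inj => v; rewrite -!dot_oprojC; set w := oproj _ v.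
have wA : w \in X (A t) by exact: oproj_mem.
apply/eqP; rewrite eq_sym; apply: contrapT => /negP neq.
have e0 : 0 < `|dot w (Xi t) - dot w xi| by rewrite normr_gt0 subr_eq0.
have /cvgrPdist_lt/(_ _ e0) nc := quot_within_cvg (bichar_derive_dot2 G Jt wA).
have {nc}/nbhs_ballP[d d0 hd] : \forall s \near t, J s ->
  `|dot w (Xi t) - dot w (Xi s)| < `|dot w (Xi t) - dot w xi| by [].
have no p q x : K p -> K q -> p < x < q -> `|t - x| < d -> False.
  move=> Kp Kq pxq tx; have := hd x tx (KJ (between Kp Kq pxq)).
  by rewrite (interiorE Kp Kq pxq).2 ltxx.
have [tq|qt] := ltP t q0.
  apply: (no t q0 (t + Num.min (d / 2) ((q0 - t) / 2)) Kt Kq0).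
    have m1 : 0 < Num.min (d / 2) ((q0 - t) / 2).
      by rewrite lt_min !divr_gt0 // subr_gt0.
    have m2 : Num.min (d / 2) ((q0 - t) / 2) <= (q0 - t) / 2 by rewrite ge_min lexx orbT.
    by apply/andP; split; lra.
  rewrite opprD addrA subrr sub0r normrN ger0_norm; last first.
    by rewrite le_min !divr_ge0 ?(ltW d0) // subr_ge0 ltW.
  by rewrite gt_min; apply/orP; left; move: d0 => /=; lra.
have pt : p0 < t by exact: lt_le_trans pq0 qt.
apply: (no p0 t (t - Num.min (d / 2) ((t - p0) / 2)) Kp0 Kt).
  have m1 : 0 < Num.min (d / 2) ((t - p0) / 2).
    by rewrite lt_min !divr_gt0 // subr_gt0.
  have m2 : Num.min (d / 2) ((t - p0) / 2) <= (t - p0) / 2 by rewrite ge_min lexx orbT.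
  by apply/andP; split; lra.
rewrite opprB addrC subrK ger0_norm; last first.
  by rewrite le_min !divr_ge0 ?(ltW d0) // subr_ge0 ltW.
by rewrite gt_min; apply/orP; left; move: d0 => /=; lra.
Qed.

Let within_velocity v : {within J, continuous (velocity v)}.
Proof.
apply: withinM; first exact: within_cst.
apply: withinB; first exact: within_cst.
by apply: withinM; exact: (bichar_continuous_dot1 G).
Qed.

(** The mean value theorem on the side of [t] where [s] lies. It reaches endpoints of [K], where
    continuity of the velocity then gives the limit. *)
Let quotient v t s : K t -> K s -> s != t -> exists2 r, K r /\ `|r - t| <= `|s - t| &
  (dot v (W s) - dot v (W t)) / (s - t) = velocity v r.
Proof.
move=> Kt Ks; have cW p q : K p -> K q -> {within `[p, q], continuous (fun r => dot v (W r))}.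
  move=> Kp Kq; have sub : `[p, q]%classic `<=` J.
    by move=> r /(segment_sub iK Kp Kq)/KJ.
  by apply: (continuous_subspaceW sub); exact: (bichar_continuous_dot1 G).
have D p q : K p -> K q -> forall x, x \in `]p, q[ ->
    is_derive x 1 (fun r => dot v (W r)) (velocity v x).
  by move=> Kp Kq x; rewrite in_itv /= => pxq; exact: (derive_dotW v Kp Kq pxq).
rewrite neq_lt => /orP[st|ts].
  have [r] := MVT st (D s t Ks Kt) (cW s t Ks Kt).
  rewrite in_itv /= => /andP[sr rt] E; exists r.
    split; first by apply: (between Ks Kt); rewrite sr.
    by rewrite !ltr0_norm ?subr_lt0 // lerN2 lerD2r ltW.
  by rewrite -opprB E -[s - t]opprB invrN mulrNN mulfK // gt_eqF ?subr_gt0.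
have [r] := MVT ts (D t s Kt Ks) (cW t s Kt Ks).
rewrite in_itv /= => /andP[tr rs] E; exists r.
  split; first by apply: (between Kt Ks); rewrite tr.
  by rewrite !gtr0_norm ?subr_gt0 // lerD2r ltW.
by rewrite E mulfK // gt_eqF ?subr_gt0.
Qed.

(** The integral curve keeps the interior momentum [xi] on all of [K]; at an endpoint on a face of
    smaller dimension, the projection reduces it to [Xi t]. *)
Lemma unbroken_nontrivial : unbroken H K gamma.
Proof.
exists (fun t => (W t, xi)); split=> t Kt; have Jt := KJ Kt; last first.
  rewrite projE /= ?(bichar_unit G Jt) // endpoint //.
  exact: surjective_pairing.
split; first exact: (bichar_unit G Jt).
pose f1 s := (s - t)^-1 *: (W s - W t).
have -> : (fun s => (s - t)^-1 *: ((W s, xi) - (W t, xi))) = (fun s => (f1 s, 0)).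
  apply/funext => s; apply/eqP; rewrite xpair_eqE /= eqxx /=.
  by rewrite subrr scaler0.
suff c1 : f1 @ within K t^' --> 2 *: (xi - dot (W t) xi *: W t).
  have c2 : (fun=> 0 : 'rV[R]_n) @ within K t^' --> (0 : 'rV[R]_n) by exact: cvg_cst.
  exact: (cvg_pair c1 c2).
apply: cvg_rowP => i e e0.
have /subspace_continuousP/(_ t Jt)/cvgrPdist_lt/(_ e e0) nv :=
  @within_velocity (delta_mx 0 i).
have {nv}/nbhs_ballP[d d0 hd] : \forall s \near t, J s ->
  `|velocity (delta_mx 0 i) t - velocity (delta_mx 0 i) s| < e by [].
suff: \forall s \near t, s != t -> K s ->
  `|(2 *: (xi - dot (W t) xi *: W t)) 0 i - f1 s 0 i| < e by [].
apply/nbhs_ballP; exists d => // s; rewrite /ball /= => ts st Ks.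
have [r [Kr rt] qE] := quotient (delta_mx 0 i) Kt Ks st.
have -> : f1 s 0 i = velocity (delta_mx 0 i) r.
  by rewrite -qE !dot_delta /f1 !mxE mulrC.
have -> : (2 *: (xi - dot (W t) xi *: W t)) 0 i = velocity (delta_mx 0 i) t.
  by rewrite /velocity !dot_delta !mxE (dotC xi).
apply: hd; last exact: KJ.
by rewrite /ball /= distrC (le_lt_trans rt) // distrC.
Qed.

End Nontrivial.

Lemma unbroken_piece K : K `<=` J -> is_interval K ->
  (forall p q x y, K p -> K q -> p < x -> x <= y -> y < q -> A x = A y) ->
  unbroken H K gamma.
Proof.
move=> KJ iK constA.
have [[p [q [Kp Kq pq]]]|triv] := pselect (exists p q, [/\ K p, K q & p < q]).
  exact: (unbroken_nontrivial KJ iK constA Kp Kq pq).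
apply: unbroken_trivial => // t u Kt Ku; apply/eqP; rewrite eq_le !leNgt.
by apply/andP; split; apply/negP => tu; apply: triv; [exists u, t|exists t, u].
Qed.

Lemma face_breaks_at_most_breaks s : face_breaks H gamma J s ->
  at_most_breaks H J gamma (size s).
Proof.
(* Division points must lie in [J] and increase strictly. *)
move=> Js; pose s' := sort <=%R (undup [seq x <- s | `[< J x >]]).
have mem_s' x : (x \in s') = (x \in s) && `[< J x >].
  by rewrite mem_sort mem_undup mem_filter andbC.
have lt_s' : sorted <%R s' by rewrite sort_lt_sorted undup_uniq.
pose t j := nth 0 s' j.
have lt_t i j : (i < j < size s')%N -> t i < t j.
  move=> /andP[ij js]; apply: (sorted_ltn_nth lt_trans _ lt_s') => //.
  by rewrite inE (ltn_trans ij).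
have le_t i j : (i <= j)%N -> (j < size s')%N -> t i <= t j.
  by rewrite leq_eqVlt => /predU1P[->//|ij] js; apply/ltW/lt_t; rewrite ij.
exists (size s'), t; split=> //.
- rewrite size_sort; apply: leq_trans (size_undup _) _.
  by rewrite size_filter count_size.
- move=> j js; have := mem_nth 0 js; rewrite mem_s' => /andP[_ /asboolP]; exact.
move=> j js; apply: unbroken_piece.
- by move=> x [].
- move=> x y [Jx x1 x2] [Jy y1 y2] z /andP[xz zy]; split.
  + by apply: (iJ Jx Jy); rewrite xz.
  + by move=> j0; apply: le_trans xz; exact: x1.
  + by move=> jm; apply: le_trans zy _; exact: y2.
move=> p q x y [Jp p1 p2] [Jq q1 q2] px xy yq.
have Jx : J x by apply: (iJ Jp Jq); apply/andP; split; lra.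
have Jy : J y by apply: (iJ Jp Jq); apply/andP; split; lra.
apply: Js => // z zs; apply/negP => /andP[xz zy].
have Jz : J z by apply: (iJ Jx Jy); rewrite xz.
have zs' : z \in s' by rewrite mem_s' zs; apply/asboolP.
(* A listed [z] inside the piece lies strictly after [t j.-1] and strictly before [t j], so no rank
   [i] is left for it. *)
pose i := index z s'; have im : (i < size s')%N by rewrite index_mem.
have ti : t i = z by rewrite /t nth_index.
have ji : (j <= i)%N.
  rewrite leqNgt; apply/negP => ij; have j0 : (0 < j)%N by apply: leq_ltn_trans ij.
  have := le_t i j.-1; rewrite -ltnS prednK // ij js ti => /(_ isT isT).
  by have := p1 j0; lra.
have [jm|] := ltnP j (size s'); last by rewrite leqNgt (leq_ltn_trans ji im).
by have := le_t j i ji im; have := q2 jm; rewrite ti; lra.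
Qed.

End Unbroken.

Theorem theoremA9 (R : realType) (n : nat) (H : many_body R n) :
  finite_set (thresholds H) ->
  globally_broken_relation H /\
  exists M : nat, forall (l : R) (J : set R) (gamma : R -> 'rV[R]_n * 'rV[R]_n),
    is_interval J -> gen_broken_bichar H l J gamma -> at_most_breaks H J gamma M.
Proof.
move=> /finite_seqP[E EE].
have EP e : thresholds H e -> e \in E by rewrite EE.
(* As X_1 = 0 lies in every X_a, the bound for [idx1] applies to all of [J]. *)
have [M MP] := breaks_bound_ex EP (idx1 H).
have bound l J gamma : is_interval J -> gen_broken_bichar H l J gamma ->
    at_most_breaks H J gamma M.
  move=> iJ G; have [|s [sM sJ]] := MP l J gamma iJ G J (@subset_refl _ J) iJ.
    by move=> t _; rewrite coll_idx1 sub0v.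
  have [m [t [ms tJ tlt tu]]] := face_breaks_at_most_breaks G iJ sJ.
  by exists m, t; split=> //; exact: leq_trans ms sM.
split; last by exists M.
move=> l gamma G; have iT : is_interval [set: R] by [].
have [m [t [_ _ tlt tu]]] := bound l _ gamma iT G.
case: m => [|m] in tlt tu.
  (* A curve without breaks still has to be divided at one point, and 0 is an arbitrary choice. *)
  exists 0%N, (fun=> 0); split=> //.
  - by apply: unbroken_sub (tu 0%N isT) => s _; split.
  - by apply: unbroken_sub (tu 0%N isT) => s _; split.
exists m, t; split.
- by move=> j jm; apply: tlt; rewrite ltnSn.
- by apply: unbroken_sub (tu 0%N isT) => s; rewrite /= in_itv.
- apply: unbroken_sub (tu m.+1 (leqnn _)) => s; rewrite /= in_itv /= andbT => ts.
  by split=> //; rewrite ltnn.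
- move=> j jm; apply: unbroken_sub (tu j.+1 _) => [s|]; last exact: ltnW.
  by rewrite /= in_itv /= => /andP[js sj]; split.
Qed.
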